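(* Let $X=X(Q_0)$ be a rearrangement invariant space. The following conditions are equivalent: (i) $\beta_X<1$; (ii) $GaRo_X\subset X^{\#}$; (iii) $X\subset X^{\#}$.
   Context: $Q_0\subset\mathbb R^n$ is a fixed cube with $|Q_0|=1$; all cubes have sides parallel to the coordinate axes. $P=P(Q_0)$ is the set of all countable (possibly finite) families $\{Q_i\}$ of subcubes of $Q_0$ with pairwise disjoint interiors. $f_Q=\frac1{|Q|}\int_Qf$. Rearrangement invariant (r.i.) space $X$ on $Q_0$: a Banach function space on $(Q_0,dx)$ which is either separable or has the Fatou property ($0\le f_n\uparrow f\in X$ implies $\|f_n\|_X\uparrow\|f\|_X$), such that $g\in X$ and $f^*=g^*$ imply $f\in X$ and $\|f\|_X=\|g\|_X$, where $f^*$ denotes the decreasing rearrangement of $|f|$. One has $L^\infty\subset X\subset L^1$ with continuous embeddings. Convention: $\|g\|_X=\infty$ if $g\notin X$. The representation space $\bar X$ is the unique r.i. space on $(0,1)$ with $\|f\|_X=\|f^*\|_{\bar X}$. For $s>0$ the dilation operator on $\bar X$ is $\sigma_sf(t)=f^*(t/s)$ if $0<t<s$ and $\sigma_sf(t)=0$ if $t\ge s$ ($t\in(0,1)$). The upper Boyd index is $\beta_X=\lim_{s\to\infty}\frac{\ln\|\sigma_s\|_{\bar X\to\bar X}}{\ln s}$. For $f\in L^1(Q_0)$ the sharp maximal function is $f^{\#}_{Q_0}(x)=\sup_{Q\ni x,\ Q\subset Q_0}\frac1{|Q|}\int_Q|f(y)-f_Q|\,dy$, $x\in Q_0$ (supremum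 over cubes), and $X^{\#}=\{f\in L^1(Q_0): f^{\#}_{Q_0}\in X\}$ with $\|f\|_{X^{\#}}=\|f^{\#}_{Q_0}\|_X$. For $f\in L^1(Q_0)$, $\Gamma_f$ is the class of integrable functions $\gamma$ on $Q_0$ such that for all $\{Q_i\}\in P$ $$\sum_i\frac1{|Q_i|}\int_{Q_i}\int_{Q_i}|f(x)-f(y)|\,dx\,dy\le\sum_i\int_{Q_i}\gamma(x)\,dx .$$ $\|f\|_{GaRo_X}=\inf\{\|\gamma\|_X:\gamma\in\Gamma_f\}$ (equal to $\infty$ if $\Gamma_f=\varnothing$), and $GaRo_X=\{f\in L^1(Q_0):\|f\|_{GaRo_X}<\infty\}$. *)

(* Defs.v *)
From HB Require Import structures.
From mathcomp Require Import all_boot all_order all_algebra.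
From mathcomp Require Import all_classical all_reals all_analysis.
From mathcomp Require Import measurable_realfun.

Set Implicit Arguments.
Unset Strict Implicit.
Unset Printing Implicit Defensive.
Import Order.TTheory GRing.Theory Num.Theory.
Import numFieldNormedType.Exports.

Local Open Scope classical_set_scope.
Local Open Scope ring_scope.
Local Open Scope ereal_scope.

Definition tcons (R : realType) (n : nat) (p : R * n.-tuple R) :
  n.+1.-tuple R := [tuple of p.1 :: p.2].

Lemma measurable_tcons (R : realType) (n : nat) :
  measurable_fun [set: R * n.-tuple R] (@tcons R n).
Proof. by apply: measurable_cons. Qed.

Section mcons.
Context {R : realType} {n : nat}.
Variable m : {sigma_finite_measure set (n.-tuple R) -> \bar R}.

(* The product of Lebesgue measure on R with m, carried to R^(n+1). *)
Definition mcons : set (n.+1.-tuple R) -> \bar R :=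
  pushforward ((@lebesgue_measure R) \x m) (@tcons R n).

Let mcons0 : mcons set0 = 0.
Proof. by rewrite /mcons /pushforward preimage_set0 measure0. Qed.

Let mcons_ge0 A : 0 <= mcons A.
Proof. by rewrite /mcons /pushforward. Qed.

Let measurable_preimage A : measurable A -> measurable (@tcons R n @^-1` A).
Proof.
by move=> mA; rewrite -[X in measurable X]setTI; exact: measurable_tcons.
Qed.

Let mcons_sigma_additive : semi_sigma_additive mcons.
Proof.
move=> F mF tF mUF; rewrite /mcons /pushforward preimage_bigcup.
apply: measure_semi_sigma_additive.
- by move=> k; exact: measurable_preimage.
- apply/trivIsetP => /= i j _ _ ij; rewrite -preimage_setI.
  by move/trivIsetP : tF => /(_ _ _ _ _ ij) ->//; rewrite preimage_set0.
- by rewrite -preimage_bigcup; exact: measurable_preimage.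
Qed.

HB.instance Definition _ := isMeasure.Build _ _ _
  mcons mcons0 mcons_ge0 mcons_sigma_additive.

Let mcons_sigma_finite : sigma_finite setT mcons.
Proof.
have /sigma_finiteP[F [TF ndF Foo]] := sigma_finiteT (@lebesgue_measure R).
have /sigma_finiteP[G [TG ndG Goo]] := sigma_finiteT m.
pose g (t : n.+1.-tuple R) : R * n.-tuple R := (thead t, [tuple of behead t]).
have mg : measurable_fun setT g.
  apply/measurable_fun_pair => /=; first exact: measurable_tnth.
  exact: measurable_behead.
have gK p : g (tcons p) = p.
  by case: p => x y; congr pair; apply/val_inj.
exists (fun k => g @^-1` (F k `*` G k)).
  rewrite -preimage_bigcup; apply/seteqP; split => // t _ /=.
  have [i _ Fi] : (\bigcup_k F k) (g t).1 by rewrite -TF.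
  have [j _ Gj] : (\bigcup_k G k) (g t).2 by rewrite -TG.
  exists (maxn i j) => //; split.
    by move: Fi; apply/subsetPset/ndF; exact: leq_maxl.
  by move: Gj; apply/subsetPset/ndG; exact: leq_maxr.
move=> k; have [mFk Fkoo] := Foo k; have [mGk Gkoo] := Goo k; split.
  by rewrite -[X in measurable X]setTI; apply: mg => //; exact: measurableX.
rewrite /mcons /pushforward /=.
have -> : @tcons R n @^-1` (g @^-1` (F k `*` G k)) = F k `*` G k.
  by rewrite -comp_preimage (_ : _ \o _ = id) ?preimage_id//; exact/funext.
by rewrite product_measure1E// lte_mul_pinfty// ge0_fin_numE.
Qed.

HB.instance Definition _ := Measure_isSigmaFinite.Build _ _ _ mcons
  mcons_sigma_finite.

End mcons.

(* Lebesgue measure on the Borel sets of R^n = n.-tuple R; see [lebn_cube] below. *)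
Fixpoint lebn (R : realType) (n : nat) :
    {sigma_finite_measure set (n.-tuple R) -> \bar R} :=
  match n with
  | 0%N => @dirac _ (0.-tuple R) [tuple] R
  | k.+1 => mcons (lebn R k)
  end.

Section cubes.
Context {R : realType} {n : nat}.
Implicit Type q : n.-tuple R * R.

(* A pair q = (a, l) stands for the cube with lower corner a and side l; it is a
   genuine cube only when 0 < l. *)
Definition cube q : set (n.-tuple R) :=
  [set x | forall i, (tnth q.1 i <= tnth x i <= tnth q.1 i + q.2)%R].

(* the interior of [cube q] *)
Definition open_cube q : set (n.-tuple R) :=
  [set x | forall i, (tnth q.1 i < tnth x i < tnth q.1 i + q.2)%R].

Definition subcube q0 q := (0 < q.2)%R /\ cube q `<=` cube q0.

(* The indexed families (Q i)_(i in I), I a finite or infinite set of naturals,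
   which form the class P(Q_0). *)
Definition cube_family q0 (I : set nat) (Q : nat -> n.-tuple R * R) :=
  (forall i, I i -> subcube q0 (Q i)) /\
  trivIset I (fun i => open_cube (Q i)).

End cubes.

Lemma measurable_cube (R : realType) (n : nat) (q : n.-tuple R * R) :
  measurable (cube q).
Proof.
have -> : cube q = \bigcap_(i in [set: 'I_n])
    ((@tnth n R ^~ i) @^-1` `[tnth q.1 i, (tnth q.1 i + q.2)%R]%classic).
  by apply/seteqP; split => x /= h i; [move=> _|]; have := h i;
    rewrite /= ?in_itv/= => // ->.
apply: fin_bigcap_measurable; first exact: finite_finset.
move=> i _; rewrite -[X in measurable X]setTI.
by apply: measurable_tnth => //; exact: measurable_itv.
Qed.

Lemma lebn_cube (R : realType) (n : nat) (q : n.-tuple R * R) : (0 <= q.2)%R ->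
  lebn R n (cube q) = (q.2 ^+ n)%:E.
Proof.
elim: n q => [|n IH] [a l] /= l0.
  rewrite diracE expr0 mem_set//= => -[]//.
have -> : mcons (lebn R n) (cube (a, l)) = ((@lebesgue_measure R) \x lebn R n)
    (`[thead a, (thead a + l)%R]%classic `*` cube ([tuple of behead a], l)).
  rewrite /mcons /pushforward; congr (_ _).
  rewrite {1}(tuple_eta a); apply/seteqP; split => -[x y] /=.
    move=> h; split; first by have := h ord0; rewrite /= !tnth0 in_itv.
    by move=> i; have := h (lift ord0 i); rewrite /= !tnthS.
  move=> [h1 h2] i; case: (unliftP ord0 i) => [j ->|->] /=.
    by rewrite /tcons !tnthS; exact: h2.
  by rewrite /tcons !tnth0; move: h1; rewrite in_itv.
rewrite product_measure1E//; last exact: measurable_cube.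
rewrite [X in _ * X]IH//= lebesgue_measure_itv/= lte_fin ltrDl exprS EFinM.
case: ltP => [_|l00]; first by rewrite -EFinB addrAC subrr add0r.
by have -> : l = 0%R by apply/le_anti/andP.
Qed.

Section function_spaces.
Context {d : measure_display} {T : measurableType d} {R : realType}.
Variables (mu : {measure set T -> \bar R}) (D : set T).
Implicit Types (f g : T -> \bar R) (N : (T -> \bar R) -> \bar R).

(* Decreasing rearrangement of |f| over the measure space (D, mu), at t > 0. *)
Definition rearr f (t : R) : \bar R :=
  ereal_inf [set s%:E | s in [set s : R |
    (0 <= s)%R /\ mu (D `&` [set x | s%:E < `|f x|]) <= t%:E]].

(* A space of (classes of) measurable functions on D is given by its norm N,
   extended by the value +oo outside of the space. *)
Definition fspace N : set (T -> \bar R) :=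
  [set f : T -> \bar R | measurable_fun D f /\ N f < +oo].

Definition norm_complete N := forall u : nat -> T -> \bar R,
  (forall k, fspace N (u k)) ->
  (forall e : R, (0 < e)%R -> exists K, forall j k, (K <= j)%N -> (K <= k)%N ->
     N (fun x => u j x - u k x) < e%:E) ->
  exists2 g, fspace N g & N (fun x => u k x - g x) @[k --> \oo] --> 0.

Definition norm_separable N := exists2 u : nat -> T -> \bar R,
  forall k, fspace N (u k) &
  forall f, fspace N f -> forall e : R, (0 < e)%R ->
    exists k, N (fun x => f x - u k x) < e%:E.

Definition fatou_property N := forall (u : nat -> T -> \bar R) f,
  (forall k, measurable_fun D (u k)) ->
  {ae mu, forall x, D x -> [/\ forall k, 0 <= u k x,
     nondecreasing_seq (fun k => u k x) & u k x @[k --> \oo] --> f x]} ->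
  fspace N f -> N (u k) @[k --> \oo] --> N f.

(* Banach function space; [bfs_Linfty] and [bfs_L1] are the embeddings of
   L^oo(D) into the space and of the space into L^1(D), D having finite
   measure. *)
Record banach_function_space N : Prop := {
  bfs_ge0 : forall f, measurable_fun D f -> 0 <= N f ;
  bfs_eq0 : forall f, measurable_fun D f ->
    N f = 0 <-> {ae mu, forall x, D x -> f x = 0} ;
  bfs_scale : forall (c : R) f, measurable_fun D f ->
    N (fun x => c%:E * f x) = `|c|%:E * N f ;
  bfs_triangle : forall f g, measurable_fun D f -> measurable_fun D g ->
    N (fun x => f x + g x) <= N f + N g ;
  bfs_ideal : forall f g, measurable_fun D f -> measurable_fun D g ->
    {ae mu, forall x, D x -> `|f x| <= `|g x|} -> N f <= N g ;
  bfs_complete : norm_complete N ;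
  bfs_Linfty : N (cst 1) < +oo ;
  bfs_L1 : exists2 C : R, (0 < C)%R &
    forall f, measurable_fun D f -> \int[mu]_(x in D) `|f x| <= C%:E * N f
}.

Record ri_space N : Prop := {
  ri_bfs : banach_function_space N ;
  ri_separable_or_fatou : norm_separable N \/ fatou_property N ;
  ri_rearr : forall f g, fspace N g -> measurable_fun D f ->
    (forall t : R, (0 < t)%R -> rearr f t = rearr g t) ->
    fspace N f /\ N f = N g
}.

End function_spaces.

Section boyd.
Context {R : realType}.

Definition unit_itv : set R := `]0%R, 1%R[%classic.

Implicit Types (Nbar : (R -> \bar R) -> \bar R) (f : R -> \bar R).

Definition representation_space (d : measure_display) (T : measurableType d)
    (mu : {measure set T -> \bar R}) (D : set T)
    (N : (T -> \bar R) -> \bar R) Nbar :=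
  ri_space (@lebesgue_measure R) unit_itv Nbar /\
  forall f : T -> \bar R, measurable_fun D f -> N f = Nbar (rearr mu D f).

Definition dilation (s : R) f (t : R) : \bar R :=
  if (t < s)%R then rearr (@lebesgue_measure R) unit_itv f (t / s)%R else 0.

Definition dilation_norm Nbar (s : R) : \bar R :=
  ereal_sup [set Nbar (dilation s f) |
    f in [set f | fspace unit_itv Nbar f /\ Nbar f <= 1]].

Definition upper_boyd_index Nbar : \bar R :=
  lim (lne (dilation_norm Nbar s) * ((ln s)^-1)%:E @[s --> +oo%R]).

End boyd.

Section sharp_garo.
Context {R : realType} {n : nat}.
Variable q0 : n.-tuple R * R.
Implicit Types (f gamma : n.-tuple R -> \bar R)
  (N : (n.-tuple R -> \bar R) -> \bar R).

Local Notation lambda := (lebn R n).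

Definition average f (A : set (n.-tuple R)) : \bar R :=
  (fine (lambda A))^-1%:E * \int[lambda]_(y in A) f y.

Definition sharp_maximal f (x : n.-tuple R) : \bar R :=
  ereal_sup [set average (fun y => `|f y - average f (cube q)|) (cube q) |
    q in [set q | subcube q0 q /\ cube q x]].

Definition sharp_space N : set (n.-tuple R -> \bar R) :=
  [set f | lambda.-integrable (cube q0) f /\
           fspace (cube q0) N (sharp_maximal f)].

Definition Gamma_class f : set (n.-tuple R -> \bar R) :=
  [set gamma | lambda.-integrable (cube q0) gamma /\
    forall (I : set nat) (Q : nat -> n.-tuple R * R), cube_family q0 I Q ->
      \sum_(0 <= i <oo | i \in I) ((fine (lambda (cube (Q i))))^-1%:E *
         \int[lambda]_(y in cube (Q i)) \int[lambda]_(x in cube (Q i))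
           `|f x - f y|)
      <= \sum_(0 <= i <oo | i \in I) \int[lambda]_(x in cube (Q i)) gamma x].

Definition garo_norm N f : \bar R := ereal_inf (N @` Gamma_class f).

Definition garo_space N : set (n.-tuple R -> \bar R) :=
  [set f | lambda.-integrable (cube q0) f /\ garo_norm N f < +oo].

End sharp_garo.

(* Main.v *)
(** (i) => (ii): if [gamma] is in [Gamma_f] then [f#] is dominated by the maximal
    function of [gamma], so Vitali's covering lemma bounds the rearrangement of [f#]
    by a multiple of the discrete Hardy operator
    [H_b g (t) = \sum_k b^-k g (b^-k t)] applied to [gamma^*]. As the dilation norms
    [phi] are submultiplicative, [beta_X < 1] means [phi b < b] for some [b > 1], and
    then [H_b gamma^*] is a norm-convergent series.
    (ii) => (iii): [2|f|] belongs to [Gamma_f].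
    (iii) => (i): for nonincreasing [F] put [f x = F |Q_x|], with [Q_x] the smallest
    cube containing [x] and sharing the lower corner of [Q_0]. Comparing the means of
    [f] on corner cubes of volumes [t] and [2t] gives [H_2 F <= 2 F + 8 (f#)^* + C],
    so [H_2] preserves the space. Since [H_2 (H_2 F) (t) >= (m+1) 2^-m F (2^-m t)], a
    gliding hump would contradict this if [phi (2^m) >= 2^m] for all [m]. *)
Require Import Defs.
From HB Require Import structures.
From mathcomp Require Import all_boot all_order all_algebra.
From mathcomp Require Import all_classical all_reals all_analysis.
From mathcomp Require Import measurable_realfun.
From mathcomp Require Import ring lra.

Set Implicit Arguments.
Unset Strict Implicit.
Unset Printing Implicit Defensive.
Import Order.TTheory GRing.Theory Num.Theory.
Import numFieldNormedType.Exports.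

Local Open Scope classical_set_scope.
Local Open Scope ring_scope.
Local Open Scope ereal_scope.

(** * Rearrangements *)

(** Taking the Hardy operator as a series of dilations turns its boundedness into a geometric series
    in [phi b / b]; completeness of the norm then puts the sum into the space. The sharp maximal
    function is an uncountable supremum. Its measurability and the use of Vitali's lemma both rest
    on one fixed sequence of cubes that exhausts every level set. The weak-type estimate keeps the
    integral of [gamma] on the level set itself; this is what permits a comparison with [gamma^*] at
    the measure of that set. The inclusion (iii) carries no norm inequality, so [H_2] is only known
    to map nonincreasing functions of the space into the space. The hump series extracts a
    contradiction from this bare fact, in place of a closed graph argument. One application of [H_2]
    would give only [2^-m F (2^-m t)], which [phi (2^m) >= 2^m] merely keeps away from 0; the second
    application supplies the unbounded factor [m+1]. *)

Section rearrangement.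
Context {d : measure_display} {T : measurableType d} {R : realType}.
Variables (mu : {measure set T -> \bar R}) (D : set T).
Hypothesis mD : measurable D.
Implicit Types f g : T -> \bar R.

Lemma measurable_abse_gt f (s : \bar R) :
  measurable_fun D f -> measurable (D `&` [set x | s < `|f x|]).
Proof.
by move=> mf; apply: emeasurable_fun_o_infty => //; exact: measurableT_comp.
Qed.

Lemma rearr_ge0 f (t : R) : 0 <= rearr mu D f t.
Proof. by apply: le_ereal_inf_tmp => _ [s [s0 _] <-]; rewrite lee_fin. Qed.

Lemma rearr_nonincreasing f (t u : R) : (t <= u)%R ->
  rearr mu D f u <= rearr mu D f t.
Proof.
move=> tu; apply: ereal_inf_le_tmp => _ [s [s0 st] <-]; exists s => //.
by split => //; rewrite (le_trans st)// lee_fin.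
Qed.

Lemma rearr_le f (s t : R) : (0 <= s)%R ->
  mu (D `&` [set x | s%:E < `|f x|]) <= t%:E -> rearr mu D f t <= s%:E.
Proof. by move=> s0 h; apply: ereal_inf_lbound; exists s. Qed.

Lemma le_rearr f (a : \bar R) (t : R) : measurable_fun D f ->
  t%:E < mu (D `&` [set x | a <= `|f x|]) -> a <= rearr mu D f t.
Proof.
move=> mf ta; apply: le_ereal_inf_tmp => _ [s [s0 st] <-].
rewrite leNgt; apply/negP => sa; move: ta; rewrite ltNge => /negP; apply.
apply: le_trans st; apply: le_measure; rewrite ?inE.
- by apply: emeasurable_fun_c_infty => //; exact: measurableT_comp.
- exact: measurable_abse_gt.
- by move=> x [Dx /= ax]; split => //=; exact: lt_le_trans ax.
Qed.

(** The infimum defining [f^*] is attained, because the distribution function is right-continuous: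
    the sets where [|f|] exceeds [s + 1/(k+1)] increase to the set where it exceeds [s]. *)
Lemma rearr_le_measure f (s t : R) : measurable_fun D f ->
  rearr mu D f t <= s%:E -> mu (D `&` [set x | s%:E < `|f x|]) <= t%:E.
Proof.
move=> mf fts.
pose F k := D `&` [set x | (s + k.+1%:R^-1)%:E < `|f x|].
have UF : \bigcup_k F k = D `&` [set x | s%:E < `|f x|].
  apply/seteqP; split => [x [k _ [Dx /= kx]]|x [Dx /= sx]].
    split => //=; apply: le_lt_trans kx.
    by rewrite lee_fin lerDl invr_ge0.
  have [fx|fx] := eqVneq (`|f x|) +oo.
    by exists 0%N => //; split => //=; rewrite fx ltry.
  have ffin : `|f x| \is a fin_num by rewrite ge0_fin_numE ?ltey.
  move: sx; rewrite -(fineK ffin) lte_fin -subr_gt0 => sx.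
  have [k] := ltr_add_invr sx.
  rewrite add0r => kx; exists k => //; split => //=.
  by rewrite -(fineK ffin) lte_fin -ltrBrDl.
have mF k : measurable (F k) by exact: measurable_abse_gt.
have ndF : nondecreasing_seq F.
  move=> i j ij; apply/subsetPset => x [Dx /= ix]; split => //=.
  apply: le_lt_trans ix; rewrite lee_fin lerD2l lef_pV2 ?posrE ?ltr0n//.
  by rewrite ler_nat.
have := nondecreasing_cvg_mu mF (bigcup_measurable (fun k _ => mF k)) ndF (mu := mu).
rewrite UF => cvF; rewrite -(cvg_lim _ cvF)//.
apply: lime_le; first by apply/cvg_ex; eexists; exact: cvF.
apply: nearW => k /=.
have : rearr mu D f t < (s + k.+1%:R^-1)%:E.
  by apply: le_lt_trans fts _; rewrite lte_fin ltrDl invr_gt0.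
move=> /ereal_inf_lt[_ [r [r0 rt] <-]]; rewrite lte_fin => rs.
apply: le_trans rt; apply: le_measure; rewrite ?inE//.
  exact: measurable_abse_gt.
by move=> x [Dx /= kx]; split => //=; apply: lt_trans kx; rewrite lte_fin.
Qed.

(** The level is an extended real because [f^*] may be infinite; the superlevel set is then
    empty. *)
Lemma measure_gt_rearr_le f (t : R) (a : \bar R) : measurable_fun D f ->
  (0 <= t)%R -> a = rearr mu D f t -> mu (D `&` [set x | a < `|f x|]) <= t%:E.
Proof.
move=> mf t0; case: a => [r fr|_|fr].
- by apply: rearr_le_measure => //; rewrite -fr.
- rewrite (_ : _ `&` _ = set0) ?measure0 ?lee_fin//.
  by apply/seteqP; split => // x [_ /=]; rewrite ltNge leey.
- by have := rearr_ge0 f t; rewrite -fr.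
Qed.

Lemma rearrZ_le f (c t : R) : (0 < c)%R -> measurable_fun D f ->
  rearr mu D (fun x => c%:E * f x) t <= c%:E * rearr mu D f t.
Proof.
move=> c0 mf; have := rearr_ge0 f t.
case E : (rearr mu D f t) => [r| |] // r0; last first.
  by rewrite gt0_muley ?lte_fin// leey.
rewrite -EFinM; apply: rearr_le.
  by rewrite mulr_ge0 ?(ltW c0).
rewrite (_ : _ `&` _ = D `&` [set x | r%:E < `|f x|]).
  by apply: rearr_le_measure => //; rewrite E.
congr (_ `&` _); apply/funext => x /=; rewrite abseM (@gee0_abs _ c%:E) ?lee_fin ?ltW//.
by rewrite EFinM lte_pmul2l.
Qed.

Lemma rearr_ae0 f (t : R) : measurable_fun D f -> (0 <= t)%R ->
  {ae mu, forall x, D x -> f x = 0} -> rearr mu D f t = 0.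
Proof.
move=> mf t0 f0; apply/eqP; rewrite eq_le rearr_ge0 andbT.
apply: rearr_le => //.
rewrite (_ : mu _ = 0) ?lee_fin//; apply: measure_negligible.
  exact: measurable_abse_gt.
apply: negligibleS f0 => x [Dx /= fx] /(_ Dx) f0.
by move: fx; rewrite f0 abse0 ltxx.
Qed.

Lemma rearr_eq0 f (t : R) : mu D <= t%:E -> measurable_fun D f ->
  rearr mu D f t = 0.
Proof.
move=> Dt mf; apply/eqP; rewrite eq_le rearr_ge0 andbT; apply: rearr_le => //.
apply: le_trans Dt; apply: le_measure; rewrite ?inE//.
exact: measurable_abse_gt.
Qed.

End rearrangement.

Section monotone_functions.
Context {R : realType}.
Implicit Type F : R -> \bar R.

Definition nonincreasing_on_line F := forall t u : R, (t <= u)%R -> F u <= F t.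

Lemma measurable_nonincreasing F (D : set R) :
  nonincreasing_on_line F -> measurable_fun D F.
Proof.
move=> niF; apply: measurable_funTS => _.
apply: (measurability _ (ErealGenOInfty.measurableE R)) => // _ [_ [x ->] <-].
rewrite setTI; apply: is_interval_measurable => t u /=.
rewrite !in_itv/= !andbT => xt xu v /andP[_ vu].
by rewrite in_itv/= andbT (lt_le_trans xu)// niF.
Qed.

Lemma measurable_unit_itv : measurable (@unit_itv R).
Proof. exact: measurable_itv. Qed.

Lemma lebesgue_unit_itv : lebesgue_measure (@unit_itv R) = 1.
Proof. by rewrite lebesgue_measure_itv/= lte_fin ltr01 sube0. Qed.

End monotone_functions.

Section rearr_rearr.
Context {d : measure_display} {T : measurableType d} {R : realType}.
Variables (mu : {measure set T -> \bar R}) (D : set T).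
Hypothesis mD : measurable D.
Local Notation leb := (@lebesgue_measure R).

Lemma rearr_dilated_nonincreasing f (b : R) : (0 <= b)%R ->
  nonincreasing_on_line (fun u => rearr mu D f (u * b)%R).
Proof.
by move=> b0 t u tu; apply: rearr_nonincreasing; rewrite ler_wpM2r.
Qed.

(** A nonincreasing function is its own rearrangement up to its jumps, and [f^*] is
    right-continuous, so nothing is lost there. The factor [b] is carried along because this is how
    dilations compose. *)
Lemma rearr_rearr f (b t : R) : measurable_fun D f -> (0 < b)%R ->
  (0 < t < 1)%R ->
  rearr leb unit_itv (fun u => rearr mu D f (u * b)%R) t =
  rearr mu D f (t * b)%R.
Proof.
move=> mf b0 /andP[t0 t1]; apply/eqP; rewrite eq_le; apply/andP; split.
  have := rearr_ge0 mu D f (t * b).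
  case E : (rearr mu D f (t * b)) => [r| |] // r0; last by rewrite leey.
  apply: rearr_le => //.
  have -> : t%:E = leb `]0%R, t[ by rewrite lebesgue_measure_itv/= lte_fin t0 sube0.
  apply: le_measure; rewrite ?inE//.
    apply: measurable_abse_gt; first exact: measurable_unit_itv.
    apply: measurable_nonincreasing.
    exact: (rearr_dilated_nonincreasing _ (ltW b0)).
  move=> u [/=]; rewrite /unit_itv/= !in_itv/= => /andP[-> _] /=.
  rewrite gee0_abs ?rearr_ge0// -E => rt; rewrite ltNge; apply/negP => tu.
  by move: rt; rewrite ltNge rearr_nonincreasing// ler_pM2r.
apply: le_ereal_inf_tmp => _ [s [s0 st] <-].
apply: rearr_le => //; rewrite leNgt; apply/negP => tbs.
(* The function exceeds [s] on all of [(0, v)], so its superlevel set has measure at least [v > t].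
   The number [m] below is a finite substitute for a measure that may be infinite, and [w] is the
   smaller of two midpoints. *)
have [v [v0 v1 vs]] : exists v : R, [/\ (t < v)%R, (v < 1)%R &
    ((v * b)%:E < mu (D `&` [set x | s%:E < `|f x|]))].
  have [m [tm ms]] : exists m : R, (t * b < m)%R /\
      m%:E <= mu (D `&` [set x | s%:E < `|f x|]).
    move: tbs; case: (mu _) => [r| |] //.
      by rewrite lte_fin => h; exists r.
    by move=> _; exists (t * b + 1)%R; rewrite ltrDl ltr01 leey.
  pose w := Num.min ((t + 1) / 2)%R ((t + m / b) / 2)%R.
  have tmb : (t < m / b)%R by rewrite ltr_pdivlMr.
  exists w; split.
  - by rewrite /w lt_min; apply/andP; split; lra.
  - by rewrite /w gt_min; apply/orP; left; lra.
  - apply: lt_le_trans ms; rewrite lte_fin -ltr_pdivlMr// /w gt_min.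
    by apply/orP; right; lra.
have : leb `]0%R, v[ <= t%:E.
  apply: le_trans st; apply: le_measure; rewrite ?inE//.
    apply: measurable_abse_gt; first exact: measurable_unit_itv.
    apply: measurable_nonincreasing.
    exact: (rearr_dilated_nonincreasing _ (ltW b0)).
  move=> u /=; rewrite in_itv/= => /andP[u0 uv]; split.
    by rewrite /unit_itv/= in_itv/= u0 (lt_trans uv).
  rewrite /= gee0_abs ?rearr_ge0// ltNge; apply/negP.
  move=> /(rearr_le_measure mD mf); apply/negP; rewrite -ltNge.
  by apply: le_lt_trans vs; rewrite lee_fin ler_pM2r// ltW.
rewrite lebesgue_measure_itv/= lte_fin (lt_trans t0)// sube0 lee_fin.
by rewrite leNgt v0.
Qed.

End rearr_rearr.

(** * Series in Banach function spaces *)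

Section banach_function_space_theory.
Context {d : measure_display} {T : measurableType d} {R : realType}.
Variables (mu : {measure set T -> \bar R}) (D : set T).
Hypothesis mD : measurable D.
Variable N : (T -> \bar R) -> \bar R.
Hypothesis bN : banach_function_space mu D N.
Implicit Types f g : T -> \bar R.

Lemma bfs_le f g : measurable_fun D f -> measurable_fun D g ->
  (forall x, D x -> `|f x| <= `|g x|) -> N f <= N g.
Proof. by move=> mf mg fg; apply: (bfs_ideal bN) => //; exact: aeW. Qed.

Lemma bfs_le_ge0 f g : measurable_fun D f -> measurable_fun D g ->
  (forall x, D x -> 0 <= f x) -> (forall x, D x -> f x <= g x) -> N f <= N g.
Proof.
move=> mf mg f0 fg; apply: bfs_le => // x Dx.
by rewrite !gee0_abs ?f0 ?fg// (le_trans (f0 _ Dx))// fg.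
Qed.

Lemma bfs_scale_ge0 (c : R) f : measurable_fun D f -> (0 <= c)%R ->
  N (fun x => c%:E * f x) = c%:E * N f.
Proof. by move=> mf c0; rewrite (bfs_scale bN)// ger0_norm. Qed.

(** Through the embedding into L^1. Finiteness is what makes differences of partial sums telescope,
    since [+oo - +oo] does not cancel. *)
Lemma fspace_ae_fin f : fspace D N f -> {ae mu, forall x, D x -> f x \is a fin_num}.
Proof.
move=> [mf Nf]; apply: integrable_ae => //; apply/integrableP; split => //.
have [C C0 /(_ _ mf) h] := bfs_L1 bN.
apply: le_lt_trans h _; apply: lte_mul_pinfty; rewrite ?lee_fin ?(ltW C0)//.
Qed.

Lemma bfs_sum (u : nat -> T -> \bar R) m k :
  (forall i, measurable_fun D (u i)) ->
  N (fun x => \sum_(m <= i < k) u i x) <= \sum_(m <= i < k) N (u i).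
Proof.
move=> mu_.
have N0 : N (fun=> 0) <= 0.
  by rewrite (bfs_eq0 bN _).2//; exact: aeW.
elim: k => [|k IH].
  by under eq_fun do rewrite big_geq//; rewrite big_geq.
have [mk|km] := leqP m k; last first.
  by under eq_fun do rewrite big_geq//; rewrite big_geq.
under eq_fun do rewrite big_nat_recr//=; rewrite big_nat_recr//=.
apply: le_trans (bfs_triangle bN _ _) _ => //.
  exact: emeasurable_sum.
exact: leeD2r.
Qed.

(** The Riesz-Fischer property. The partial sums are Cauchy and have a norm limit [g]; each of them
    is almost everywhere at most [|g|], hence so is the pointwise sum, and the ideal property
    concludes. *)
Lemma fspace_nneseries (u : nat -> T -> \bar R) :
  (forall i, measurable_fun D (u i)) ->
  (forall i x, D x -> 0 <= u i x) ->
  \sum_(0 <= i <oo) N (u i) < +oo ->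
  fspace D N (fun x => \sum_(0 <= i <oo) u i x).
Proof.
move=> mu_ u0 Nu; pose v k x := \sum_(0 <= i < k) u i x.
have N0 i : 0 <= N (u i) by exact: (bfs_ge0 bN).
have mv k : measurable_fun D (v k) by exact: emeasurable_sum.
have v0 k x : D x -> 0 <= v k x.
  by move=> Dx; apply: sume_ge0 => i _; exact: u0.
have fv k : fspace D N (v k).
  split => //; apply: le_lt_trans (bfs_sum _ _ mu_) _.
  by apply: le_lt_trans Nu; apply: nneseries_lim_ge.
have mS : measurable_fun D (fun x => \sum_(0 <= i <oo) u i x).
  by apply: ge0_emeasurable_sum => // i x Dx _; exact: u0.
have Nvv (j k : nat) : (j <= k)%N ->
    N (fun x => v j x - v k x) <= \sum_(j <= i <oo) N (u i) /\
    N (fun x => v k x - v j x) <= \sum_(j <= i <oo) N (u i).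
  move=> jk.
  have aux w : measurable_fun D w ->
      {ae mu, forall x, D x -> `|w x| <= `|\sum_(j <= i < k) u i x|} ->
      N w <= \sum_(j <= i <oo) N (u i).
    move=> mw aw.
    apply: le_trans (bfs_ideal bN mw _ aw) _; first exact: emeasurable_sum.
    apply: le_trans (bfs_sum _ _ mu_) _.
    exact: nneseries_lim_ge.
  have key : {ae mu, forall x, D x ->
      v k x - v j x = \sum_(j <= i < k) u i x}.
    have := fspace_ae_fin (fv j); apply: filterS => x vfin Dx.
    have vx := vfin Dx.
    by rewrite /v (big_cat_nat (n := j))//= addeAC subee ?add0e.
  split; apply: aux.
  - exact: emeasurable_funB.
  - have := fspace_ae_fin (fv k); apply: filterS2 key => x xk vfin Dx.
    rewrite -xk// -abseN fin_num_oppeB ?vfin//.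
    by rewrite addeC.
  - exact: emeasurable_funB.
  - by apply: filterS key => x xk Dx; rewrite xk.
have [g fg vg] : exists2 g, fspace D N g & N (fun x => v k x - g x) @[k --> \oo] --> 0.
  apply: (bfs_complete bN) => // e e0.
  have /= := nneseries_tail_cvg Nu (fun i _ => N0 i).
  move=> /fine_cvgP[_] /cvgrPdist_lt/(_ _ e0) [K _ HK].
  have tail k : (K <= k)%N -> \sum_(k <= i <oo) N (u i) < e%:E.
    move=> Kk; have := HK _ Kk; rewrite /= sub0r normrN.
    have t0 : 0 <= \sum_(k <= i <oo) N (u i) by exact: nneseries_ge0.
    rewrite ger0_norm ?fine_ge0// -lte_fin fineK// ge0_fin_numE//.
    apply: le_lt_trans Nu; rewrite (@nneseries_split _ _ 0%N k)//= add0n.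
    by rewrite leeDr// sume_ge0.
  exists K => j k Kj Kk; have [jk|kj] := leqP j k.
    exact: le_lt_trans (Nvv _ _ jk).1 (tail _ Kj).
  exact: le_lt_trans (Nvv _ _ (ltnW kj)).2 (tail _ Kk).
have [mg Ng] := fg.
have vleg K : {ae mu, forall x, D x -> v K x <= `|g x|}.
  (* The excess of [v K] over [|g|] is at most [|v k - g|] for every [k >= K], so its norm is below
     a sequence tending to 0. *)
  pose w x := maxe (v K x - `|g x|) 0.
  have mw : measurable_fun D w.
    apply: measurable_maxe => //; apply: emeasurable_funB => //.
    exact: measurableT_comp.
  have w0 x : 0 <= w x by rewrite le_max lexx orbT.
  have Nw : N w = 0.
    apply/eqP; rewrite eq_le (bfs_ge0 bN)// andbT.
    rewrite -(cvg_lim _ vg)//; apply: lime_ge; first by apply/cvg_ex; eexists; exact: vg.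
    near=> k; apply: bfs_le => // [|x Dx]; first exact: emeasurable_funB.
    rewrite gee0_abs// ge_max abse_ge0 andbT.
    have Kk : v K x <= v k x.
      have Kk : (K <= k)%N by near: k; exists K.
      by rewrite /v [leRHS](big_cat_nat (n := K))//= leeDl// sume_ge0// => i _; exact: u0.
    apply: le_trans (_ : v k x - `|g x| <= _); first exact: leeB.
    case: (v k x) (v0 k _ Dx) (g x) => [a| |] // a0 [c| |]//=; rewrite ?leNye ?leey//.
    rewrite -!EFinB lee_fin; apply: le_trans (ler_norm _).
    by rewrite lerB// ler_norm.
  move/(bfs_eq0 bN mw).1 : Nw; apply: filterS => x w0' Dx.
  have {w0' w0} := w0' Dx; rewrite /w => h.
  have : v K x - `|g x| <= 0 by rewrite -h le_max lexx.
  move: (abse_ge0 (g x)) (v0 K _ Dx).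
  case: (v K x) => [a| |]; case: (`|g x|) => [c| |] //; rewrite ?leey// => _ _.
  by rewrite -EFinB !lee_fin subr_le0.
split => //.
apply: le_lt_trans Ng; apply: (bfs_ideal bN) => //.
have := ae_foralln vleg; apply: filterS => x vx Dx.
rewrite gee0_abs; last by apply: nneseries_ge0 => i _ _; exact: u0.
apply: lime_le.
  by apply: is_cvg_nneseries => i _ _; exact: u0.
by apply: nearW => k; exact: vx.
Unshelve. all: by end_near. Qed.

End banach_function_space_theory.

(** * The upper Boyd index *)

Section fekete.
Context {R : realType}.
Variable p : R -> R.
Hypothesis p_ge1 : forall s, (1 <= s -> 1 <= p s)%R.
Hypothesis p_le : forall s t, (1 <= s -> s <= t -> p s <= p t)%R.
Hypothesis pM : forall s t, (1 <= s -> 1 <= t -> p (s * t) <= p s * p t)%R.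
Local Open Scope ring_scope.

Lemma submultiplicativeX (s : R) m : 1 <= s -> p (s ^+ m.+1) <= p s ^+ m.+1.
Proof.
move=> s1; elim: m => [|m IH]; first by rewrite !expr1.
rewrite exprS; apply: le_trans (pM _ _) _ => //; first by rewrite exprn_ege1.
rewrite [leRHS]exprS ler_wpM2l// (le_trans _ (p_ge1 s1))//.
Qed.

Lemma submultiplicative_ln_cvg : exists L : R,
  [/\ forall s, 1 < s -> L <= ln (p s) / ln s,
      forall e, 0 < e -> exists2 s, 1 < s & ln (p s) / ln s < L + e &
      ln (p s) / ln s @[s --> +oo] --> L].
Proof.
pose S := [set ln (p s) / ln s | s in [set s : R | 1 < s]].
have S0 : S !=set0 by exists (ln (p 2) / ln 2); exists 2; rewrite //= ltr1n.
have lS : has_lbound S.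
  exists 0 => _ [s /= s1 <-].
  by rewrite divr_ge0// ln_ge0// ?p_ge1// ltW.
have lb s : 1 < s -> inf S <= ln (p s) / ln s.
  by move=> s1; apply: ge_inf => //; exists s.
have adh e : 0 < e -> exists2 s, 1 < s & ln (p s) / ln s < inf S + e.
  move=> e0; have [_ [s s1 <-] h] := inf_adherent e0 (conj S0 lS).
  by exists s.
exists (inf S); split => //.
apply/cvgrPdist_le => e e0.
have [s0 s01 hs0] := adh (e / 2) ltac:(by rewrite divr_gt0).
have ls0 : 0 < ln s0 by rewrite ln_gt0.
have lp0 : 0 <= ln (p s0) by rewrite ln_ge0// p_ge1// ltW.
near=> s.
have s1 : 1 < s by near: s; apply: nbhs_pinfty_gt; rewrite num_real.
have ls : 0 < ln s by rewrite ln_gt0.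
(* The price of rounding the exponent [ln s / ln s0] up to the integer [m.+1] is one extra factor
   [p s0]. *)
have sbig : ln (p s0) / ln s <= e / 2.
  rewrite ler_pdivrMr// mulrC -ler_pdivrMr ?divr_gt0//.
  by rewrite -[leLHS]expRK ler_ln ?posrE ?expR_gt0 ?(lt_trans ltr01)//.
rewrite distrC ger0_norm ?subr_ge0 ?lb//.
rewrite lerBlDl.
pose m := Num.truncn (ln s / ln s0).
have /andP[m1 m2] : (m%:R <= ln s / ln s0 < m.+1%:R)%R.
  by rewrite truncn_itv// divr_ge0// ltW.
have ssm : s <= s0 ^+ m.+1.
  rewrite -ler_ln ?posrE ?exprn_gt0 ?(lt_trans ltr01)// lnXn ?(lt_trans ltr01)//.
  by rewrite -mulr_natl -ler_pdivrMr// ltW.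
have lps : ln (p s) <= m.+1%:R * ln (p s0).
  have ps0 : 0 < p s0 by rewrite (lt_le_trans ltr01)// p_ge1// ltW.
  rewrite mulr_natl -lnXn// ler_ln ?posrE ?exprn_gt0//.
    apply: le_trans (submultiplicativeX m (ltW s01)).
    by apply: p_le => //; exact: ltW.
  by rewrite (lt_le_trans ltr01)// p_ge1// ltW.
apply: (@le_trans _ _ (ln (p s0) / ln s0 + ln (p s0) / ln s)); last first.
  by rewrite (le_trans (lerD (ltW hs0) sbig))// -addrA -splitr.
rewrite ler_pdivrMr// mulrDl divfK ?gt_eqF//.
apply: le_trans lps _; rewrite -natr1 mulrDl mul1r lerD2r.
rewrite (_ : _ / _ * _ = ln s / ln s0 * ln (p s0)); first exact: ler_wpM2r.
by rewrite mulrAC [RHS]mulrAC (mulrC (ln s)).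
Unshelve. all: by end_near. Qed.

End fekete.

(** * Dilation norms *)

Section boyd_index.
Context {R : realType}.
Variable Nbar : (R -> \bar R) -> \bar R.
Local Notation leb := (@lebesgue_measure R).
Hypothesis riN : ri_space leb unit_itv Nbar.
Let bN := ri_bfs riN.
Let mI := @measurable_unit_itv R.
Local Notation phi := (dilation_norm Nbar).
Implicit Types f g : R -> \bar R.

Lemma eq_rearr d (T : measurableType d) (mu : {measure set T -> \bar R})
    (D : set T) (f g : T -> \bar R) t :
  (forall x, D x -> f x = g x) -> rearr mu D f t = rearr mu D g t.
Proof.
move=> fg; rewrite /rearr; congr ereal_inf; congr image.
apply/funext => s /=; congr (_ /\ mu _ <= _).
by apply/seteqP; split => x [Dx /=]; rewrite fg.
Qed.

Lemma bfs_eq f g : measurable_fun unit_itv f -> measurable_fun unit_itv g ->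
  (forall t, unit_itv t -> f t = g t) -> Nbar f = Nbar g.
Proof.
by move=> mf mg fg; apply/eqP; rewrite eq_le; apply/andP; split;
  apply: (bfs_le bN) => // t It; rewrite fg.
Qed.

Lemma unit_itvE (t : R) : unit_itv t <-> (0 < t < 1)%R.
Proof. by rewrite /unit_itv /= in_itv. Qed.

Lemma dilationE s f t : (1 <= s)%R -> unit_itv t ->
  dilation s f t = rearr leb unit_itv f (t / s).
Proof.
by move=> s1 /unit_itvE/andP[_ t1]; rewrite /dilation (lt_le_trans t1).
Qed.

Lemma dilation_ge0 s f t : 0 <= dilation s f t.
Proof. by rewrite /dilation; case: ifP => // _; exact: rearr_ge0. Qed.

Lemma measurable_dilation s f : (0 < s)%R -> measurable_fun unit_itv (dilation s f).
Proof.
move=> s0; apply: measurable_nonincreasing => t u tu; rewrite /dilation.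
case: ifPn => us; last by case: ifP => _; rewrite ?rearr_ge0.
by rewrite (le_lt_trans tu us) rearr_nonincreasing// ler_wpM2r// invr_ge0 ltW.
Qed.

Lemma Nbar_dilation_le s g : (1 <= s)%R -> fspace unit_itv Nbar g ->
  Nbar (dilation s g) <= phi s * Nbar g.
Proof.
move=> s1 [mg Ng].
have s0 : (0 < s)%R by rewrite (lt_le_trans ltr01).
have md f := measurable_dilation f s0.
have [Ng0|Ng0] := eqVneq (Nbar g) 0.
  rewrite Ng0 mule0 le_eqVlt; apply/orP; left; apply/eqP.
  apply: (bfs_eq0 bN (md g)).2; apply: aeW => t It.
  rewrite dilationE//; apply: rearr_ae0 => //.
    by move/unit_itvE : It => /andP[t0 _]; rewrite ltW// divr_gt0.
  exact: (bfs_eq0 bN mg).1.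
have Ngge0 := bfs_ge0 bN mg.
have Ngfin : Nbar g \is a fin_num by rewrite ge0_fin_numE.
pose c := fine (Nbar g).
have c0 : (0 < c)%R by rewrite fine_gt0// lt_neqAle eq_sym Ng0 Ngge0/=.
pose h x := c^-1%:E * g x.
have mh : measurable_fun unit_itv h by exact: measurable_funeM.
have gh : g = (fun x => c%:E * h x).
  apply/funext => x; rewrite /h muleA -EFinM mulfV ?gt_eqF// mul1e//.
have Nh : Nbar h = 1.
  rewrite (bfs_scale_ge0 bN)// ?invr_ge0 ?ltW// -(fineK Ngfin) -EFinM mulVf//.
  by rewrite gt_eqF.
have : Nbar (dilation s h) <= phi s.
  by apply: ereal_sup_ubound; exists h => //; split; rewrite /= /fspace/= ?Nh ?ltry.
move=> h1; rewrite -(fineK Ngfin) -/c muleC.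
apply: le_trans (_ : c%:E * Nbar (dilation s h) <= _); last first.
  by rewrite lee_wpmul2l// lee_fin ltW.
rewrite -(bfs_scale_ge0 bN) ?(ltW c0)//; last exact: md.
apply: (bfs_le_ge0 bN); [exact: md|by apply: measurable_funeM; exact: md| |].
  by move=> x _; exact: dilation_ge0.
move=> t It; rewrite !dilationE// {1}gh; exact: rearrZ_le.
Qed.

(** Tested on the constant 1, which a dilation by [s >= 1] leaves unchanged on the unit interval and
    whose norm is finite and nonzero. *)
Lemma dilation_norm_ge1 s : (1 <= s)%R -> 1 <= phi s.
Proof.
move=> s1; have s0 : (0 < s)%R by rewrite (lt_le_trans ltr01).
have mc : measurable_fun unit_itv (cst 1 : R -> \bar R) by [].
have N1 := bfs_ge0 bN mc; have N2 := bfs_Linfty bN.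
have N3 : Nbar (cst 1) != 0.
  apply/eqP => /(bfs_eq0 bN mc).1 [A [mA A0 IA]].
  have : leb unit_itv <= leb A.
    apply: le_measure; rewrite ?inE// => t It; apply: IA => /= /(_ It) /eqP.
    by rewrite onee_eq0.
  by rewrite lebesgue_unit_itv A0 leNgt lte01.
have fc : fspace unit_itv Nbar (cst 1 : R -> \bar R) by split.
have h := Nbar_dilation_le s1 fc.
have Nfin : Nbar (cst 1) \is a fin_num by rewrite ge0_fin_numE.
have N0 : 0 < Nbar (cst 1) by rewrite lt_neqAle eq_sym N3.
have : Nbar (cst 1) <= phi s * Nbar (cst 1).
  apply: le_trans h; apply: (bfs_le_ge0 bN) => //; first exact: measurable_dilation.
  move=> t /[dup] It /unit_itvE/andP[t0 t1]; rewrite dilationE//.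
  apply: le_rearr => //.
  rewrite (_ : _ `&` _ = unit_itv).
    rewrite [ltRHS]lebesgue_unit_itv lte_fin ltr_pdivrMr// mul1r.
    exact: lt_le_trans s1.
  by apply/seteqP; split => [x []//|x Ix]; split => //=; rewrite normr1.
by rewrite -[leLHS]mul1e lee_pmul2r.
Qed.

Lemma dilation_norm_le s t : (1 <= s)%R -> (s <= t)%R -> phi s <= phi t.
Proof.
move=> s1 st; apply: ge_ereal_sup => _ [f ff <-].
have s0 : (0 < s)%R by rewrite (lt_le_trans ltr01).
have t1 : (1 <= t)%R by exact: le_trans st.
apply: (@le_trans _ _ (Nbar (dilation t f))); last first.
  by apply: ereal_sup_ubound; exists f.
apply: (bfs_le_ge0 bN).
- exact: measurable_dilation.
- by apply: measurable_dilation; rewrite (lt_le_trans ltr01).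
- by move=> x _; exact: dilation_ge0.
- move=> u /[dup] Iu /unit_itvE/andP[u0 u1]; rewrite !dilationE//.
  by apply: rearr_nonincreasing; rewrite ler_pM2l// lef_pV2 ?posrE// (lt_le_trans s0).
Qed.

Lemma dilation_normM s t : (1 <= s)%R -> (1 <= t)%R ->
  phi (s * t)%R <= phi s * phi t.
Proof.
move=> s1 t1; apply: ge_ereal_sup => _ [f [[mf Nf] f1] <-].
have s0 : (0 < s)%R by rewrite (lt_le_trans ltr01).
have t0 : (0 < t)%R by rewrite (lt_le_trans ltr01).
have st1 : (1 <= s * t)%R by rewrite mulr_ege1.
have sb : Nbar (dilation t f) <= phi t by apply: ereal_sup_ubound; exists f.
(* [Nbar_dilation_le] speaks only of members of the space; if the first dilation leaves it, [phi t]
   is already infinite. *)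
have [Noo|Noo] := eqVneq (Nbar (dilation t f)) +oo.
  move: sb; rewrite Noo leye_eq => /eqP ->.
  by rewrite gt0_muley ?leey// (lt_le_trans _ (dilation_norm_ge1 s1)).
apply: (@le_trans _ _ (phi s * Nbar (dilation t f))); last first.
  by rewrite lee_wpmul2l// (le_trans _ (dilation_norm_ge1 s1)).
have fd : fspace unit_itv Nbar (dilation t f).
  by split; [exact: measurable_dilation|rewrite ltey].
apply: le_trans (Nbar_dilation_le s1 fd).
rewrite le_eqVlt; apply/orP; left; apply/eqP; apply: bfs_eq.
- by apply: measurable_dilation; rewrite mulr_gt0.
- exact: measurable_dilation.
move=> u /[dup] Iu /unit_itvE/andP[u0 u1]; rewrite !dilationE//.
transitivity (rearr leb unit_itv (fun v => rearr leb unit_itv f (v * t^-1)%R) (u / s)).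
  rewrite rearr_rearr ?invr_gt0 ?divr_gt0//= ?ltr_pdivrMr ?mul1r ?(lt_le_trans u1)//.
  by rewrite invfM mulrA.
by apply: eq_rearr => v Iv; rewrite dilationE.
Qed.

(** By Fekete's lemma the limit is the infimum of [ln (phi s) / ln s], so it is below 1 exactly when
    one quotient is. If [phi] is infinite on all [s > 1], the index is [+oo] and both sides fail;
    otherwise finiteness at one [s0 > 1] spreads to all [s >= 1] by submultiplicativity and
    monotonicity. *)
Lemma upper_boyd_index_lt1 :
  upper_boyd_index Nbar < 1 <-> exists2 s : R, (1 < s)%R & phi s < s%:E.
Proof.
have phi0 s : (1 <= s)%R -> 0 <= phi s.
  by move=> s1; rewrite (le_trans _ (dilation_norm_ge1 s1)).
have [[s0 s01 ps0]|noo] := pselect (exists2 s : R, (1 < s)%R & phi s < +oo); last first.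
  have poo (s : R) : (1 < s)%R -> phi s = +oo.
    move=> s1; apply/eqP; rewrite -leye_eq leNgt; apply/negP => h.
    by apply: noo; exists s.
  have -> : upper_boyd_index Nbar = +oo.
    apply/cvg_lim => //; apply: cvg_near_cst.
    near=> s; have s1 : (1 < s)%R.
      by near: s; apply: nbhs_pinfty_gt; rewrite num_real.
    by rewrite poo//= gt0_mulye// lte_fin invr_gt0 ln_gt0.
  by split => // -[s s1]; rewrite poo.
have poo (s : R) : (1 <= s)%R -> phi s \is a fin_num.
  move=> s1; rewrite ge0_fin_numE ?phi0//.
  have pX m : phi (s0 ^+ m.+1)%R < +oo.
    elim: m => [|m IH]; first by rewrite expr1.
    rewrite exprS; apply: le_lt_trans (dilation_normM _ _) _.
    - exact: ltW.
    - by rewrite exprn_ege1// ltW.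
    - by rewrite lte_mul_pinfty// ?phi0 ?ltW// ge0_fin_numE ?phi0 ?ltW.
  pose m := Num.truncn (ln s / ln s0).
  have /andP[_ m2] : (m%:R <= ln s / ln s0 < m.+1%:R)%R.
    by rewrite truncn_itv// divr_ge0// ?ln_ge0// ltW.
  apply: le_lt_trans (pX m); apply: dilation_norm_le => //.
  have s_gt0 : (0 < s)%R by exact: lt_le_trans s1.
  have s0_gt0 : (0 < s0)%R by exact: lt_trans s01.
  rewrite -ler_ln ?posrE ?exprn_gt0// lnXn//.
  by rewrite -mulr_natl -ler_pdivrMr ?ln_gt0// ltW.
pose p s := fine (phi s).
have pE (r : R) : (1 <= r)%R -> phi r = (p r)%:E.
  by move=> r1; rewrite /p (fineK (poo r r1)).
have p1 (s : R) : (1 <= s)%R -> (1 <= p s)%R.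
  by move=> s1; rewrite -lee_fin -pE// dilation_norm_ge1.
have [L [lb adh cvL]] : exists L : R,
  [/\ forall s, (1 < s)%R -> (L <= ln (p s) / ln s)%R,
      forall e, (0 < e)%R -> exists2 s, (1 < s)%R & (ln (p s) / ln s < L + e)%R &
      (ln (p s) / ln s)%R @[s --> +oo%R] --> L].
  apply: submultiplicative_ln_cvg => //.
  - by move=> s t s1 st; rewrite -lee_fin -!pE ?dilation_norm_le// (le_trans s1).
  - by move=> s t s1 t1; rewrite -lee_fin EFinM -!pE ?dilation_normM ?mulr_ege1.
have -> : upper_boyd_index Nbar = L%:E.
  apply/cvg_lim => //.
  apply: (@cvg_trans _ ((ln (p s) / ln s)%:E @[s --> +oo%R])); last first.
    by apply: cvg_EFin; [exact: nearW|exact: cvL].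
  apply: near_eq_cvg; near=> s.
  have s1 : (1 < s)%R by near: s; apply: nbhs_pinfty_gt; rewrite num_real.
  by rewrite pE ?ltW// lne_EFin ?EFinM// (lt_le_trans ltr01)// p1 ?ltW.
have lnp (s : R) : (1 < s)%R -> (ln (p s) / ln s < 1)%R = (phi s < s%:E).
  move=> s1; rewrite pE ?ltW// lte_fin ltr_pdivrMr ?ln_gt0// mul1r ltr_ln//.
    by rewrite posrE (lt_le_trans ltr01)// p1 ?ltW.
  by rewrite posrE (lt_trans ltr01).
rewrite lte_fin; split => [L1|[s s1]].
  have /adh[s s1 h] : (0 < 1 - L)%R by rewrite subr_gt0.
  by exists s => //; rewrite -lnp// (lt_le_trans h)//; lra.
by rewrite -lnp//; exact/le_lt_trans/lb.
Unshelve. all: by end_near. Qed.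

End boyd_index.

(** * The discrete Hardy operator *)

Section geometric_dilation.
Context {R : realType}.
Implicit Type F : R -> \bar R.

(* A discrete substitute for the Hardy operator: for nonincreasing [F >= 0] it is
   comparable to [(1/t) \int_0^t F]. *)
Definition hardy_sum (a : R) F (t : R) : \bar R :=
  \sum_(0 <= k <oo) (a ^+ k)%:E * F (t * a ^+ k)%R.

Variable a : R.
Hypothesis a0 : (0 < a)%R.

Lemma hardy_sum_term_ge0 F t k : (forall t, 0 <= F t) ->
  0 <= (a ^+ k)%:E * F (t * a ^+ k)%R.
Proof. by move=> F0; rewrite mule_ge0// lee_fin exprn_ge0// ltW. Qed.

Lemma hardy_sum_ge0 F t : (forall t, 0 <= F t) -> 0 <= hardy_sum a F t.
Proof.
by move=> F0; apply: nneseries_ge0 => k _ _; exact: hardy_sum_term_ge0.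
Qed.

Lemma hardy_sum_nonincreasing F : (forall t, 0 <= F t) ->
  nonincreasing_on_line F -> nonincreasing_on_line (hardy_sum a F).
Proof.
move=> F0 niF t u tu; apply: lee_nneseries => [k _ _|k _].
  exact: hardy_sum_term_ge0.
have ak : (0 <= a ^+ k)%R by rewrite exprn_ge0// ltW.
by rewrite lee_wpmul2l ?lee_fin// niF// ler_wpM2r.
Qed.

Lemma hardy_sum_ge_term F t k : (forall t, 0 <= F t) ->
  (a ^+ k)%:E * F (t * a ^+ k)%R <= hardy_sum a F t.
Proof.
move=> F0; apply: le_trans (nneseries_lim_ge k.+1 _); last first.
  by move=> i _ _; exact: hardy_sum_term_ge0.
rewrite big_nat_recr//= leeDr// sume_ge0// => i _.
exact: hardy_sum_term_ge0.
Qed.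

(** The double sum has terms [a^(i+j) F (t a^(i+j))], and exactly [m+1] pairs satisfy
    [i + j = m]. *)
Lemma hardy_sum2_ge F t m : (forall t, 0 <= F t) ->
  (m.+1%:R * a ^+ m)%:E * F (t * a ^+ m)%R <= hardy_sum a (hardy_sum a F) t.
Proof.
move=> F0; have HF0 u : 0 <= hardy_sum a F u by exact: hardy_sum_ge0.
apply: le_trans (nneseries_lim_ge m.+1 _); last first.
  by move=> i _ _; exact: hardy_sum_term_ge0.
rewrite EFinM -muleA.
set c := _ * F _.
have c0 : 0 <= c by exact: hardy_sum_term_ge0.
have -> : m.+1%:R%:E * c = \sum_(0 <= i < m.+1) c.
  elim: m.+1 => [|j IH]; first by rewrite big_geq// mul0e.
  by rewrite big_nat_recr//= -IH -natr1 EFinD ge0_muleDl ?lee_fin// mul1e.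
rewrite !big_mkord; apply: lee_sum => -[i] /=; rewrite ltnS => im _.
apply: (@le_trans _ _ ((a ^+ i)%:E *
    ((a ^+ (m - i))%:E * F (t * a ^+ i * a ^+ (m - i))%R))).
  by rewrite muleA -EFinM -mulrA -exprD subnKC.
by rewrite lee_wpmul2l ?lee_fin ?exprn_ge0 ?(ltW a0)// hardy_sum_ge_term.
Qed.

End geometric_dilation.

Lemma geometric_nneseries_lty (R : realType) (c q : R) : (0 <= c)%R ->
  (0 <= q < 1)%R -> \sum_(0 <= k <oo) (c * q ^+ k)%:E < +oo.
Proof.
move=> c0 /andP[q0 q1].
have q1' : (0 < 1 - q)%R by rewrite subr_gt0.
apply: (@le_lt_trans _ _ (c / (1 - q))%:E); last exact: ltry.
apply: lime_le.
  by apply: is_cvg_nneseries => k _ _; rewrite lee_fin mulr_ge0// exprn_ge0.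
apply: nearW => m; rewrite sumEFin lee_fin.
rewrite (_ : (\sum_(_ <= _ < _) _)%R = (c * (1 - q ^+ m) / (1 - q))%R); last first.
  by have := congr1 (fun f => f m) (@geometric_seriesE _ c q (negbT (lt_eqF q1))).
rewrite ler_pM2r ?invr_gt0// ler_piMr// lerBlDr lerDl exprn_ge0//.
Qed.

Section hardy_sum_bounded.
Context {d : measure_display} {T : measurableType d} {R : realType}.
Variables (mu : {measure set T -> \bar R}) (D : set T).
Hypothesis mD : measurable D.
Variable Nbar : (R -> \bar R) -> \bar R.
Local Notation leb := (@lebesgue_measure R).
Hypothesis riN : ri_space leb unit_itv Nbar.
Let bN := ri_bfs riN.
Local Notation phi := (dilation_norm Nbar).

Lemma hardy_sum_rearr_fspace f (b : R) : measurable_fun D f -> (1 < b)%R ->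
  phi b < b%:E -> Nbar (rearr mu D f) < +oo ->
  Nbar (hardy_sum b^-1 (rearr mu D f)) < +oo.
Proof.
move=> mf b1 pb Nf.
have b0 : (0 < b)%R by rewrite (lt_trans ltr01).
have a0 : (0 < b^-1)%R by rewrite invr_gt0.
pose g k (u : R) := rearr mu D f (u * b^-1 ^+ k)%R.
have ak k : (0 < b^-1 ^+ k)%R by rewrite exprn_gt0.
have mg k : measurable_fun unit_itv (g k).
  by apply: measurable_nonincreasing; apply: rearr_dilated_nonincreasing; exact: ltW.
have pge := dilation_norm_ge1 riN (ltW b1).
have pfin : phi b \is a fin_num.
  by rewrite ge0_fin_numE ?(lt_trans pb) ?ltry// (le_trans _ pge).
pose p := fine (phi b); have pE : phi b = p%:E by rewrite fineK.
have p1 : (1 <= p)%R by rewrite -lee_fin -pE.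
have N0 : Nbar (g 0%N) = Nbar (rearr mu D f).
  by congr Nbar; apply/funext => u; rewrite /g expr0 mulr1.
have Nfin : Nbar (g 0%N) \is a fin_num.
  by rewrite ge0_fin_numE; [rewrite N0|exact: (bfs_ge0 bN (mg 0%N))].
pose c := fine (Nbar (g 0%N)).
have c0 : (0 <= c)%R by rewrite fine_ge0// (bfs_ge0 bN (mg 0%N)).
(* On the unit interval [g k.+1] is the dilation of [g k] by [b], so each step costs a factor [p],
   against the factor [b^-1] in the series. *)
have Ng k : Nbar (g k) <= (c * p ^+ k)%:E.
  elim: k => [|k IH]; first by rewrite expr0 mulr1 fineK.
  have fg : fspace unit_itv Nbar (g k).
    by split => //; apply: le_lt_trans IH _; rewrite ltry.
  have -> : Nbar (g k.+1) = Nbar (dilation b (g k)).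
    apply: (bfs_eq riN) => //; first exact: measurable_dilation.
    move=> u /[dup] Iu /unit_itvE/andP[u0 u1]; rewrite dilationE ?(ltW b1)//.
    rewrite /g rearr_rearr ?exprn_gt0 ?divr_gt0//=.
      by rewrite exprS mulrA.
    by rewrite ltr_pdivrMr// mul1r (lt_trans u1).
  apply: le_trans (Nbar_dilation_le riN (ltW b1) fg) _.
  rewrite pE exprS mulrCA EFinM lee_wpmul2l// lee_fin (le_trans _ p1)//.
pose v k (u : R) := (b^-1 ^+ k)%:E * g k u.
have mv k : measurable_fun unit_itv (v k) by exact: measurable_funeM.
have v0 k u : unit_itv u -> 0 <= v k u.
  by move=> _; rewrite mule_ge0 ?lee_fin ?(ltW (ak k))// rearr_ge0.
suff Nv : \sum_(0 <= k <oo) Nbar (v k) < +oo.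
  by have [|_] := fspace_nneseries _ bN mv v0 Nv; first exact: measurable_itv.
apply: (@le_lt_trans _ _ (\sum_(0 <= k <oo) (c * (p / b) ^+ k)%:E)).
  apply: lee_nneseries => [k _ _|k _].
    exact: (bfs_ge0 bN (mv k)).
  rewrite (bfs_scale_ge0 bN (mg k)) ?(ltW (ak k))//.
  rewrite exprMn mulrA mulrC EFinM lee_wpmul2l// lee_fin ltW//.
apply: geometric_nneseries_lty => //.
rewrite divr_ge0 ?(ltW b0) ?(le_trans _ p1)//=.
by rewrite ltr_pdivrMr// mul1r -lte_fin -pE.
Qed.

End hardy_sum_bounded.

Section layer.
Context {d : measure_display} {T : measurableType d} {R : realType}.
Variables (mu : {measure set T -> \bar R}) (D : set T).
Hypothesis mD : measurable D.

(* Cut [E] along the level sets of [|f|] at the heights [f^*(m b^-k)]. *)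
Lemma integral_le_hardy_sum f (E : set T) (m b : R) : measurable_fun D f ->
  measurable E -> E `<=` D -> mu E = m%:E -> (0 < m)%R -> (1 < b)%R ->
  \int[mu]_(x in E) `|f x| <= (m * b)%:E * hardy_sum b^-1 (rearr mu D f) m.
Proof.
move=> mf mE ED muE m0 b1.
have b0 : (0 < b)%R by rewrite (lt_trans ltr01).
have a0 : (0 < b^-1)%R by rewrite invr_gt0.
pose h k := rearr mu D f (m * b^-1 ^+ k)%R.
have h0 k : 0 <= h k by exact: rearr_ge0.
have ak k : (0 < b^-1 ^+ k)%R by rewrite exprn_gt0.
pose A k := D `&` [set x | h k < `|f x|].
have mA k : measurable (A k) by exact: measurable_abse_gt.
have muA k : mu (A k) <= (m * b^-1 ^+ k)%:E.
  by apply: measure_gt_rearr_le => //; rewrite mulr_ge0// ltW.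
have mfE : measurable_fun E (fun x => `|f x|).
  by apply: measurableT_comp => //; exact: measurable_funS mf.
have mterm k : measurable_fun E ((cst (h k.+1)) \_ (A k)).
  by apply/measurable_restrict => //; exact: measurable_cst.
have term0 k x : 0 <= ((cst (h k.+1)) \_ (A k)) x.
  by apply: erestrict_ge0 => y _; exact: h0.
have msum : measurable_fun E (fun x => \sum_(0 <= k <oo) ((cst (h k.+1)) \_ (A k)) x).
  by apply: ge0_emeasurable_sum => [k x _ _|k _]; [exact: term0|exact: mterm].
apply: (@le_trans _ _ (\int[mu]_(x in E)
    (h 0%N + \sum_(0 <= k <oo) ((cst (h k.+1)) \_ (A k)) x))).
  apply: ae_ge0_le_integral => //.
  - by move=> x _; rewrite adde_ge0// nneseries_ge0.
  - exact: emeasurable_funD.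
  (* Where the pointwise bound fails, [|f|] exceeds [h 0]; and once [x] lies in [A i], the series
     contains [h i.+1], so [x] lies in [A i.+1] too. Such points lie in every [A k], and [mu (A k)]
     tends to 0. *)
  exists (\bigcap_k A k); split.
  - exact: bigcapT_measurable.
  - apply/eqP; rewrite eq_le measure_ge0 andbT.
    apply/lee_addgt0Pr => e e0; rewrite add0e.
    have cv : (m * b^-1 ^+ k)%R @[k --> \oo] --> (m * 0)%R.
      apply: cvgMr; apply: cvg_expr.
      by rewrite gtr0_norm// invf_lt1.
    move/cvgrPdist_lt : cv => /(_ _ e0) [K _ /(_ K (leqnn K))].
    rewrite mulr0 sub0r normrN gtr0_norm ?mulr_gt0// => Ke.
    apply: le_trans (_ : mu (A K) <= _).
      apply: le_measure; rewrite ?inE//; first exact: bigcapT_measurable.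
      exact: bigcap_inf.
    by apply: le_trans (muA K) _; rewrite lee_fin ltW.
  move=> x /= /not_implyP[Ex /negP]; rewrite -ltNge => lx k _.
  suff : forall i, A i x by [].
  elim=> [|i IH]; split; [exact: ED| |exact: ED|] => /=.
    by apply: le_lt_trans lx; rewrite leeDl// nneseries_ge0.
  apply: le_lt_trans lx.
  apply: (@le_trans _ _ (\sum_(0 <= k <oo) ((cst (h k.+1)) \_ (A k)) x)).
    apply: le_trans (nneseries_lim_ge i.+1 _) => //.
    rewrite big_nat_recr//= {2}/patch mem_set// leeDr// sume_ge0//.
  by rewrite leeDr.
rewrite ge0_integralD//; last by move=> x _; rewrite nneseries_ge0.
rewrite integral_nneseries//.
under eq_eseriesr do rewrite -integral_mkcondr.
(* The height [h k.+1] sits on a set of measure at most [m b^-k], which is [m b] times [b^-(k+1)]: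
   the factor [b] of the statement comes from this shift of index. *)
have E1 k : \int[mu]_(x in E `&` A k) (cst (h k.+1)) x <=
    (m * b)%:E * ((b^-1 ^+ k.+1)%:E * h k.+1).
  rewrite integral_cst; last exact: measurableI.
  rewrite muleC muleA -EFinM; apply: lee_wpmul2r => //.
  apply: le_trans (_ : mu (A k) <= _).
    by apply: le_measure; rewrite ?inE//; exact: measurableI.
  apply: le_trans (muA k) _; rewrite lee_fin exprS mulrA mulfK ?gt_eqF//.
have E0 : \int[mu]_(x in E) h 0%N <= (m * b)%:E * ((b^-1 ^+ 0)%:E * h 0%N).
  rewrite (integral_cst mu mE (h 0%N)) muE expr0 mul1e muleC lee_wpmul2r//.
  by rewrite lee_fin ler_peMr ?ltW.
apply: le_trans (leeD E0 (lee_nneseries _ (fun k _ => E1 k))) _.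
  by move=> k _ _; apply: integral_ge0 => x _; exact: h0.
rewrite nneseriesZl ?lee_fin; last first.
  by move=> k _; rewrite mule_ge0// lee_fin ltW.
rewrite -ge0_muleDr; last 2 first.
- by rewrite mule_ge0// lee_fin ltW.
- by rewrite nneseries_ge0// => k _ _; rewrite mule_ge0// lee_fin ltW.
apply: lee_wpmul2l; first by rewrite lee_fin mulr_ge0// ltW.
rewrite /hardy_sum [leRHS]nneseries_recl//; last first.
  by move=> k _; rewrite mule_ge0// ?rearr_ge0// lee_fin ltW.
apply: leeD => //; rewrite -(@nneseries_addn _ _ 1%N); last first.
  by move=> k; rewrite mule_ge0// ?rearr_ge0// lee_fin ltW.
by under [leRHS]eq_eseriesr do rewrite addn1.
Qed.

End layer.

(** * Cubes *)

Section cube_geometry.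
Context {R : realType} {n : nat}.
Implicit Types q : n.-tuple R * R.
Local Notation lambda := (lebn R n).
Local Open Scope ring_scope.

Lemma cube_subsetP q q' : 0 <= q.2 -> cube q `<=` cube q' ->
  forall i, tnth q'.1 i <= tnth q.1 i /\
    tnth q.1 i + q.2 <= tnth q'.1 i + q'.2.
Proof.
move=> q0 qq' i; split.
  have : cube q q.1 by move=> j; rewrite lexx lerDl.
  by move=> /qq' /(_ i) /andP[].
have : cube q [tuple tnth q.1 j + q.2 | j < n].
  by move=> j; rewrite tnth_mktuple lerDl q0 lexx.
by move=> /qq' /(_ i); rewrite tnth_mktuple => /andP[].
Qed.

Lemma subset_cube q q' : (forall i, tnth q'.1 i <= tnth q.1 i /\
    tnth q.1 i + q.2 <= tnth q'.1 i + q'.2) -> cube q `<=` cube q'.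
Proof.
move=> h x qx i; have [h1 h2] := h i; have /andP[x1 x2] := qx i.
by rewrite (le_trans h1)//= (le_trans x2).
Qed.

Lemma cube_side_le q q' : (0 < n)%N -> 0 <= q.2 -> cube q `<=` cube q' ->
  q.2 <= q'.2.
Proof.
by move=> n0 q0 qq'; have [] := cube_subsetP q0 qq' (Ordinal n0); lra.
Qed.

(* Rational parameters, clipped so that the cube stays inside [cube q0]. *)
Definition clipped_cube q0 (rc : n.-tuple rat * rat) : n.-tuple R * R :=
  let l := Num.min (ratr rc.2) q0.2 in
  ([tuple Num.max (tnth q0.1 i)
      (Num.min (ratr (tnth rc.1 i)) (tnth q0.1 i + q0.2 - l)) | i < n], l).

(** The approximation is from outside, so that a point of the given cube stays in the approximating
    one. Codes that give no positive side fall back on [q0]. *)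
Lemma cube_sequence q0 : 0 < q0.2 -> (0 < n)%N ->
  exists Q : nat -> n.-tuple R * R, (forall k, subcube q0 (Q k)) /\
  forall q, subcube q0 q -> forall e, 0 < e ->
    exists k, cube q `<=` cube (Q k) /\ (Q k).2 < q.2 + e.
Proof.
move=> q00 n0.
pose Q k := if @unpickle (n.-tuple rat * rat)%type k is Some rc then
  if (0 < ratr rc.2 :> R) then clipped_cube q0 rc else q0 else q0.
have sub0 : subcube q0 q0 by split.
exists Q; split.
  move=> k; rewrite /Q; case: unpickle => [[c r]|] //=; case: ifPn => // r0.
  split; first by rewrite /= lt_min r0.
  apply: subset_cube => i; rewrite tnth_mktuple /=.
  set l := Num.min (ratr r) q0.2.
  have lL : l <= q0.2 by rewrite ge_min lexx orbT.
  split; first by rewrite le_max lexx.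
  rewrite -lerBrDr ge_max; apply/andP; split; first lra.
  by rewrite ge_min; apply/orP; right; lra.
move=> q [q_gt0 qq0] e e0.
have [r] : exists r : rat, ratr r \in `]q.2, (q.2 + e)[.
  by apply: rat_in_itvoo; rewrite ltrDl.
rewrite in_itv/= => /andP[r1 r2].
have r0 : 0 < ratr r :> R by exact: lt_trans r1.
(* As [r] exceeds the side of [q], this interval is nonempty; each of its points starts an interval
   of length [r] covering the [i]-th edge of [q]. *)
have /choice[c Hc] : forall i : 'I_n, exists c : rat,
    ratr c \in `](tnth q.1 i + q.2 - ratr r), (tnth q.1 i)[.
  by move=> i; apply: rat_in_itvoo; lra.
exists (pickle ([tuple c i | i < n], r)).
rewrite /Q pickleK /= r0; split; last by rewrite /= gt_min r2.
have bd := cube_subsetP (ltW q_gt0) qq0.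
apply: subset_cube => i; rewrite /clipped_cube /= !tnth_mktuple /=.
have [b1 b2] := bd i; have := Hc i; rewrite in_itv/= => /andP[c1 c2].
split; first by rewrite ge_max b1 ge_min (ltW c2).
rewrite -lerBlDr le_max.
have [rL|Lr] := leP (ratr r) q0.2.
  by rewrite le_min; apply/orP; right; apply/andP; split; lra.
by apply/orP; left; lra.
Qed.

Definition triple_cube q : n.-tuple R * R :=
  ([tuple tnth q.1 i - q.2 | i < n], 3 * q.2).

Lemma cube_sub_triple q q' : q'.2 <= q.2 -> cube q `&` cube q' !=set0 ->
  cube q' `<=` cube (triple_cube q).
Proof.
move=> qq' [x [qx q'x]] y q'y i; rewrite tnth_mktuple /=.
have := qx i; have := q'x i; have := q'y i; move=> /andP[? ?] /andP[? ?] /andP[? ?].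
by apply/andP; split; lra.
Qed.

Lemma max_side (s : seq (n.-tuple R * R)) : s != [::] ->
  exists2 q, q \in s & forall q', q' \in s -> q'.2 <= q.2.
Proof.
elim: s => // q s IH _; have [->|/IH[p ps Hp]] := eqVneq s [::].
  by exists q => [|q']; rewrite ?mem_head// inE => /eqP ->.
have [qp|pq] := leP q.2 p.2.
  exists p => [|q']; first by rewrite inE ps orbT.
  by rewrite inE => /predU1P[->//|/Hp].
exists q => [|q']; first by rewrite mem_head.
by rewrite inE => /predU1P[->//|/Hp /le_trans]; apply; exact: ltW.
Qed.

End cube_geometry.

(** * Vitali's covering lemma for finitely many cubes *)

Section vitali.
Context {R : realType} {n : nat}.
Implicit Types q : n.-tuple R * R.
Local Notation lambda := (lebn R n).

Lemma measurable_cubes (s : seq (n.-tuple R * R)) :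
  measurable (\big[setU/set0]_(q <- s) cube q).
Proof. by apply: bigsetU_measurable => q _; exact: measurable_cube. Qed.

(* Vitali's greedy argument: a largest cube [q] absorbs, in its triple, every cube
   which it meets, and is disjoint from the remaining ones. *)
Lemma vitali_integral (D : set (n.-tuple R)) (g : n.-tuple R -> \bar R) (K : R)
    (s : seq (n.-tuple R * R)) :
  measurable D -> measurable_fun D g -> (forall x, D x -> 0 <= g x) -> (0 <= K)%R ->
  (forall q, q \in s -> [/\ (0 < q.2)%R, cube q `<=` D &
      K%:E * lambda (cube q) <= \int[lambda]_(x in cube q) g x]) ->
  K%:E * lambda (\big[setU/set0]_(q <- s) cube q) <=
  (3 ^+ n)%:E * \int[lambda]_(x in \big[setU/set0]_(q <- s) cube q) g x.
Proof.
move=> mD mg g0 K0; have [m] := ubnP (size s); elim: m s => // m IH s sm Hs.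
have [->|s0] := eqVneq s [::].
  by rewrite !big_nil measure0 mule0 integral_set0 mule0.
have [q qs qmax] := max_side s0.
pose s' := [seq q' <- s | `[< cube q `&` cube q' = set0 >]].
have s's : {subset s' <= s} by move=> q'; rewrite mem_filter => /andP[].
have [q_gt0 qD Kq] := Hs _ qs.
have IHs' : K%:E * lambda (\big[setU/set0]_(q <- s') cube q) <=
  (3 ^+ n)%:E * \int[lambda]_(x in \big[setU/set0]_(q <- s') cube q) g x.
  apply: IH => [|q' /s's]; last exact: Hs.
  (* [s'] is strictly shorter than [s], since [q] meets itself and is filtered out. *)
  rewrite -ltnS (leq_trans _ sm)// ltnS size_filter.
  rewrite -(count_predC (fun q' => `[< cube q `&` cube q' = set0 >]) s).
  rewrite -addn1 leq_add2l -has_count; apply/hasP; exists q => //=.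
  apply/asboolPn => qq; have : (cube q `&` cube q) q.1.
    by split => i; rewrite lexx lerDl ltW.
  by rewrite qq.
set U := \big[setU/set0]_(q <- s) cube q.
set U' := \big[setU/set0]_(q <- s') cube q in IHs' *.
have mU : measurable U by exact: measurable_cubes.
have mU' : measurable U' by exact: measurable_cubes.
have mq := measurable_cube.
have UE x : U x <-> exists2 q', q' \in s & cube q' x.
  by rewrite /U -bigcup_seq; split => -[q' ? ?]; exists q'.
have U'E x : U' x <-> exists2 q', q' \in s' & cube q' x.
  by rewrite /U' -bigcup_seq; split => -[q' ? ?]; exists q'.
have UD : U `<=` D by move=> x /UE[q' /Hs[_ + _]]; exact.
have UU' : U `<=` cube (triple_cube q) `|` U'.
  move=> x /UE[q' q's q'x].
  have [qq'|qq'] := pselect (cube q `&` cube q' = set0).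
    by right; apply/U'E; exists q' => //; rewrite mem_filter q's andbT; apply/asboolP.
  by left; apply: (cube_sub_triple (qmax _ q's)) q'x; exact/set0P/eqP.
have qU'U : cube q `|` U' `<=` U.
  move=> x [qx|/U'E[q' /s's q's q'x]]; apply/UE; first by exists q.
  by exists q'.
have qU'0 : [disjoint cube q & U'].
  apply/disj_setPS => x [qx /U'E[q' + q'x]].
  rewrite mem_filter => /andP[/asboolP qq' _].
  by rewrite -qq'.
have q3 : lambda (cube (triple_cube q)) = (3 ^+ n)%:E * lambda (cube q).
  rewrite !lebn_cube ?ltW//= ?mulr_gt0//.
  by rewrite exprMn EFinM.
have c3 : (0 <= 3 ^+ n :> R)%R by rewrite exprn_ge0.
apply: (@le_trans _ _ (K%:E * (lambda (cube (triple_cube q)) + lambda U'))).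
  rewrite lee_wpmul2l ?lee_fin//.
  apply: le_trans (measureU2 _ (mq _ _ _) mU').
  by apply: le_measure; rewrite ?inE//; apply: measurableU => //; exact: mq.
rewrite ge0_muleDr// q3 muleCA.
apply: (@le_trans _ _ ((3 ^+ n)%:E * (\int[lambda]_(x in cube q) g x +
    \int[lambda]_(x in U') g x))).
  rewrite ge0_muleDr; last 2 first.
  - by apply: integral_ge0 => x /qD; exact: g0.
  - apply: integral_ge0 => x /U'E[q' /s's q's q'x]; apply: g0.
    by have [_ + _] := Hs _ q's; exact.
  by apply: leeD => //; rewrite lee_wpmul2l ?lee_fin.
rewrite lee_wpmul2l ?lee_fin// -ge0_integral_setU//.
- apply: ge0_subset_integral => //; first by apply: measurableU => //; exact: mq.
    exact: measurable_funS mg.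
  by move=> x /UD; exact: g0.
- exact: mq.
- by apply: measurable_funS mg => // x /qU'U /UD.
- by move=> x /qU'U /UD; exact: g0.
Qed.

End vitali.

(** * Mean oscillation and the sharp maximal function *)

Section oscillation.
Context {R : realType} {n : nat}.
Variable q0 : n.-tuple R * R.
Hypotheses (n0 : (0 < n)%N) (q00 : (0 < q0.2)%R).
Implicit Types (q : n.-tuple R * R) (f g : n.-tuple R -> \bar R).
Local Notation lambda := (lebn R n).

Definition oscillation f q : \bar R :=
  average (fun y => `|f y - average f (cube q)|) (cube q).

Lemma subcube_integrable f q : lambda.-integrable (cube q0) f ->
  subcube q0 q -> lambda.-integrable (cube q) f.
Proof.
by move=> fi [_ qq0]; apply: integrableS fi => //; exact: measurable_cube.
Qed.

Lemma averageE f q : (0 <= q.2)%R ->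
  average f (cube q) = (q.2 ^+ n)^-1%:E * \int[lambda]_(y in cube q) f y.
Proof. by move=> q_ge0; rewrite /average lebn_cube. Qed.

Lemma average_fin f q : lambda.-integrable (cube q) f -> (0 <= q.2)%R ->
  average f (cube q) \is a fin_num.
Proof.
move=> fi q_ge0; rewrite averageE// fin_numM// integrable_fin_num//.
exact: measurable_cube.
Qed.

Lemma integrable_cst_cube q (c : R) : (0 <= q.2)%R ->
  lambda.-integrable (cube q) (cst c%:E).
Proof.
move=> q_ge0; apply/integrableP; split; first exact: measurable_cst.
rewrite (integral_cst lambda (measurable_cube q) `|c%:E|).
by rewrite [X in _ * X](@lebn_cube _ _ q)// -EFinM ltry.
Qed.

Lemma integrable_subr_cst f q (c : R) : lambda.-integrable (cube q) f ->
  (0 <= q.2)%R -> lambda.-integrable (cube q) (fun x => `|f x - c%:E|).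
Proof.
move=> fi q_ge0; apply: integrable_abse => //.
by apply: integrableB => //; [exact: measurable_cube|exact: integrable_cst_cube].
Qed.

Lemma measurable_abse_subr f q (c : \bar R) : measurable_fun (cube q) f ->
  measurable_fun (cube q) (fun x => `|f x - c|).
Proof. by move=> mf; apply: measurableT_comp => //; exact: emeasurable_funB. Qed.

Lemma oscillation_ge0 f q : (0 <= q.2)%R -> 0 <= oscillation f q.
Proof.
move=> q_ge0; rewrite /oscillation averageE// mule_ge0 ?lee_fin ?invr_ge0 ?exprn_ge0//.
exact: integral_ge0.
Qed.

(** Dominated convergence with bound [|f|]. A point outside [q] misses it by some [e > 0] in one
    coordinate, and [Q j], which contains [q], reaches less than [1/(j+1)] beyond it. *)
Lemma integral_subcubes_cvg f q (Q : nat -> n.-tuple R * R) :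
  lambda.-integrable (cube q0) f -> subcube q0 q ->
  (forall j, subcube q0 (Q j)) -> (forall j, cube q `<=` cube (Q j)) ->
  (forall j, (Q j).2 < q.2 + j.+1%:R^-1)%R ->
  \int[lambda]_(x in cube (Q j)) f x @[j --> \oo] -->
  \int[lambda]_(x in cube q) f x.
Proof.
move=> fi [q_gt0 qq0] Q0 qQ Qq.
have mcube (p : n.-tuple R * R) : measurable (cube p) by exact: measurable_cube.
have mf : measurable_fun (cube q0) f by exact: measurable_int fi.
have E (p : n.-tuple R * R) : cube p `<=` cube q0 ->
    \int[lambda]_(x in cube p) f x = \int[lambda]_(x in cube q0) (f \_ (cube p)) x.
  by move=> pq0; rewrite -integral_mkcondr setIidr.
have mr (p : n.-tuple R * R) : measurable_fun (cube q0) (f \_ (cube p)).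
  by apply/measurable_restrict => //; exact: measurable_funS mf.
have -> : (fun j => \int[lambda]_(x in cube (Q j)) f x) =
    (fun j => \int[lambda]_(x in cube q0) (f \_ (cube (Q j))) x).
  by apply/funext => j; apply: E; have [] := Q0 j.
rewrite (E q)//.
have [] := @dominated_convergence _ _ _ lambda _ (mcube q0)
  (fun j => f \_ (cube (Q j))) (f \_ (cube q)) (fun x => `|f x|) => //.
- apply: aeW => x q0x; apply: cvg_near_cst.
  have [qx|nqx] := pselect (cube q x).
    by apply: nearW => j; rewrite /patch !mem_set//; exact: qQ.
  have [i /negP nqi] : exists i, ~ (tnth q.1 i <= tnth x i <= tnth q.1 i + q.2)%R.
    exact/existsNP.
  have [e e0 He] : exists2 e, (0 < e)%R &
      ((tnth x i <= tnth q.1 i - e) || (tnth q.1 i + q.2 + e <= tnth x i))%R.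
    move: nqi; rewrite negb_and -!ltNge => /orP[xq|qx].
      by exists (tnth q.1 i - tnth x i)%R; rewrite ?subr_gt0// subKr lexx.
    exists (tnth x i - (tnth q.1 i + q.2))%R; rewrite ?subr_gt0//.
    by apply/orP; right; lra.
  near=> j; rewrite /patch (memNset nqx) memNset// => Qjx.
  have ej : (j.+1%:R^-1 < e)%R by near: j; exact: (near_infty_natSinv_lt (PosNum e0)).
  have [c1 c2] := cube_subsetP (ltW q_gt0) (qQ j) i.
  have /andP[x1 x2] := Qjx i; have Qj := Qq j.
  move: ej Qj c1 c2 x1 x2 He; move: (_^-1)%R => w.
  by move=> ? ? ? ? ? ? /orP[?|?]; lra.
- exact: integrable_abse.
- apply: aeW => x j _; rewrite /patch; case: ifP => _; rewrite ?abse0//.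
Unshelve. all: by end_near. Qed.

(** Only lower semicontinuity is wanted. On [q] one has [|f - c| <= |f - cj| + |cj - c|];
    integrating, and enlarging [q] to [Q j] in the first term, bounds the oscillation on [Q j] below
    by a quantity tending to the oscillation on [q]. *)
Lemma oscillation_approx f q (Q : nat -> n.-tuple R * R) (s : R) :
  lambda.-integrable (cube q0) f -> subcube q0 q ->
  (forall j, subcube q0 (Q j)) -> (forall j, cube q `<=` cube (Q j)) ->
  (forall j, (Q j).2 < q.2 + j.+1%:R^-1)%R ->
  s%:E < oscillation f q -> exists j, s%:E < oscillation f (Q j).
Proof.
move=> fi sq Q0 qQ Qq soq.
have mcube (p : n.-tuple R * R) : measurable (cube p) by exact: measurable_cube.
have mf : measurable_fun (cube q0) f by exact: measurable_int fi.
have Ic := integral_subcubes_cvg fi sq Q0 qQ Qq.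
have q_gt0 := sq.1; have Q_gt0 j := (Q0 j).1.
have fq := subcube_integrable fi sq; have fQ j := subcube_integrable fi (Q0 j).
pose V := (q.2 ^+ n)%R; pose W j := ((Q j).2 ^+ n)%R.
have V0 : (0 < V)%R by rewrite exprn_gt0.
have W0 j : (0 < W j)%R by rewrite exprn_gt0.
have WV : W j @[j --> \oo] --> V.
  have lcvg : (Q j).2 @[j --> \oo] --> q.2.
    apply/cvgrPdist_lt => e e0; near=> j; rewrite ltr_distlC; apply/andP; split.
      by rewrite (lt_le_trans _ (cube_side_le n0 (ltW q_gt0) (qQ j)))// ltrBlDr ltrDl.
    apply: lt_trans (Qq j) _; rewrite ltrD2l.
    by near: j; exact: (near_infty_natSinv_lt (PosNum e0)).
  exact: (cvg_comp _ (fun x : R => x ^+ n)%R lcvg (@exprn_continuous _ _ _)).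
pose c := fine (average f (cube q)); pose cj j := fine (average f (cube (Q j))).
have cE : average f (cube q) = c%:E by rewrite fineK// average_fin// ltW.
have cjE j : average f (cube (Q j)) = (cj j)%:E by rewrite fineK// average_fin// ltW.
have cc : cj j @[j --> \oo] --> c.
  have -> : cj = (fun j => (W j)^-1 * fine (\int[lambda]_(x in cube (Q j)) f x))%R.
    by apply/funext => j; rewrite /cj averageE ?ltW// fineM// integrable_fin_num.
  have -> : c = (V^-1 * fine (\int[lambda]_(x in cube q) f x))%R.
    by rewrite /c averageE ?ltW// fineM// integrable_fin_num.
  apply: cvgM; first by apply: cvgV => //; rewrite gt_eqF.
  by apply: fine_cvg; rewrite fineK ?integrable_fin_num.
pose D := fine (\int[lambda]_(x in cube q) `|f x - c%:E|).
have DE : \int[lambda]_(x in cube q) `|f x - c%:E| = D%:E.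
  rewrite /D fineK//; apply: integrable_fin_num => //.
  by apply: integrable_subr_cst => //; exact: ltW.
have low j : ((W j)^-1 * (D - V * `|cj j - c|))%:E <= oscillation f (Q j).
  rewrite /oscillation cjE averageE; last exact: ltW.
  rewrite EFinM; apply: lee_wpmul2l; first by rewrite lee_fin invr_ge0 ltW.
  rewrite EFinB leeBlDr//.
  apply: (@le_trans _ _ (\int[lambda]_(x in cube q) (`|f x - (cj j)%:E| + `|cj j - c|%:E))).
    rewrite -DE; apply: ge0_le_integral => //.
    - exact: measurable_abse_subr (measurable_int _ fq).
    - apply: emeasurable_funD => //; exact: measurable_abse_subr (measurable_int _ fq).
    move=> x _; case: (f x) => [r| |] //=; rewrite ?leey// -?EFinD lee_fin.
    by rewrite (_ : r - c = r - cj j + (cj j - c))%R ?ler_normD//; lra.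
  rewrite ge0_integralD//; last exact: measurable_abse_subr (measurable_int _ fq).
  rewrite (integral_cst lambda (mcube q) `|cj j - c|%:E).
  rewrite [X in _ + _ * X](@lebn_cube _ _ q); last exact: ltW.
  apply: leeD; last by rewrite -EFinM mulrC.
  apply: ge0_subset_integral => //.
  exact: measurable_abse_subr (measurable_int _ (fQ j)).
have lim : ((W j)^-1 * (D - V * `|cj j - c|))%R @[j --> \oo] -->
    (V^-1 * (D - V * `|c - c|))%R.
  apply: cvgM; first by apply: cvgV => //; rewrite gt_eqF.
  apply: cvgB; first exact: cvg_cst.
  apply: cvgMr; apply: cvg_norm; apply: cvgB => //; exact: cvg_cst.
move: lim; rewrite subrr normr0 mulr0 subr0 => lim.
have sVD : (s < V^-1 * D)%R.
  by move: soq; rewrite /oscillation cE averageE ?ltW// DE -EFinM lte_fin.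
have : \forall j \near \oo, (s < (W j)^-1 * (D - V * `|cj j - c|))%R.
  exact: (cvgr_gt _ lim).
by move=> [j _ /(_ j (leqnn j)) sj]; exists j; apply: lt_le_trans (low j); rewrite lte_fin.
Unshelve. all: by end_near. Qed.

End oscillation.

(* No measurability is needed: the integral of a nonnegative function is the
   supremum of the integrals of the simple functions below it. *)
Lemma ge0_le_integral_unmeasurable d (T : measurableType d) (R : realType)
    (mu : {measure set T -> \bar R}) (D : set T) (f g : T -> \bar R) :
  (forall x, D x -> 0 <= f x) -> (forall x, D x -> f x <= g x) ->
  \int[mu]_(x in D) f x <= \int[mu]_(x in D) g x.
Proof.
move=> f0 fg; have g0 x : D x -> 0 <= g x by move=> Dx; rewrite (le_trans (f0 x Dx))// fg.
rewrite !ge0_integralE//; apply: ereal_sup_le => _ [h /= hf <-]; exists h => //= x.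
by apply: le_trans (hf x) _; exact: lee_restrict.
Qed.

Lemma eseries_set1 (R : realType) (F : nat -> \bar R) :
  \sum_(0 <= i <oo | i \in [set 0%N]) F i = F 0%N.
Proof.
apply/cvg_lim => //; apply: cvg_near_cst; exists 1%N => // -[//|m] _ /=.
rewrite big_ltn_cond// mem_set//= big_nat_cond big_pred0 ?adde0//.
by move=> i; rewrite in_set1 /=; case: i => [|i]; rewrite //= andbF.
Qed.

(** * Level sets of the sharp maximal function, and the class [Gamma_f] *)

Section sharp_maximal_theory.
Context {R : realType} {n : nat}.
Variable q0 : n.-tuple R * R.
Hypotheses (n0 : (0 < n)%N) (q00 : (0 < q0.2)%R).
Implicit Types (q : n.-tuple R * R) (f g : n.-tuple R -> \bar R).
Local Notation lambda := (lebn R n).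

Let mcube q : measurable (cube q). Proof. exact: measurable_cube. Qed.

Lemma sharp_maximal_ge f q x : subcube q0 q -> cube q x ->
  oscillation f q <= sharp_maximal q0 f x.
Proof. by move=> sq qx; apply: ereal_sup_ubound; exists q. Qed.

Lemma sharp_maximal_ge0 f x : cube q0 x -> 0 <= sharp_maximal q0 f x.
Proof.
move=> q0x; have sq0 : subcube q0 q0 by split.
apply: le_trans (sharp_maximal_ge f sq0 q0x).
exact: oscillation_ge0 (ltW q00).
Qed.

(** One sequence of cubes serves all levels [s]: a cube through [x] with oscillation above [s] is
    replaced by a slightly larger member of the sequence, still containing [x]. *)
Lemma sharp_maximal_level f : lambda.-integrable (cube q0) f ->
  exists Q : nat -> n.-tuple R * R, (forall k, subcube q0 (Q k)) /\
  forall s : R, cube q0 `&` [set x | s%:E < sharp_maximal q0 f x] =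
    \bigcup_(k in [set k | s%:E < oscillation f (Q k)]) cube (Q k).
Proof.
move=> fi; have [Q [Q0 HQ]] := cube_sequence q00 n0.
exists Q; split => // s; apply/seteqP; split => [x [q0x /= sx]|x [k /= sk Qx]].
  have [_ [q [sq qx] <-] sosc] := ereal_sup_gt sx.
  have /choice[k Hk] : forall j : nat, exists k,
      cube q `<=` cube (Q k) /\ ((Q k).2 < q.2 + j.+1%:R^-1)%R.
    by move=> j; apply: HQ.
  have [j sj] := @oscillation_approx _ _ _ n0 f q (fun j => Q (k j)) s fi sq
    (fun j => Q0 (k j)) (fun j => (Hk j).1) (fun j => (Hk j).2) sosc.
  by exists (k j) => //; apply: (Hk j).1.
split; first exact: (Q0 k).2.
exact: lt_le_trans sk (sharp_maximal_ge f (Q0 k) Qx).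
Qed.

Lemma measurable_sharp_maximal f : lambda.-integrable (cube q0) f ->
  measurable_fun (cube q0) (sharp_maximal q0 f).
Proof.
move=> fi mq0; apply: (measurability _ (ErealGenOInfty.measurableE R)) => //.
move=> _ [_ [s ->] <-]; have [Q [Q0 HQ]] := sharp_maximal_level fi.
rewrite preimage_itvoy HQ; apply: bigcup_measurable => k _.
exact: mcube.
Qed.

(** A cube with oscillation above [s] lies entirely in the level set, which is why the right-hand
    integral is confined to it. Vitali's lemma is applied to finite unions [U m], which then
    increase to the level set. *)
Lemma sharp_maximal_weak_type f g (s : R) : lambda.-integrable (cube q0) f ->
  measurable_fun (cube q0) g ->
  (forall q, subcube q0 q -> oscillation f q <= average (fun x => `|g x|) (cube q)) ->
  (0 < s)%R ->
  s%:E * lambda (cube q0 `&` [set x | s%:E < sharp_maximal q0 f x]) <=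
  (3 ^+ n)%:E *
    \int[lambda]_(x in cube q0 `&` [set x | s%:E < sharp_maximal q0 f x]) `|g x|.
Proof.
move=> fi mg fg s0; have [Q [Q0 HQ]] := sharp_maximal_level fi.
set E := _ `&` _; have EQ : E = _ := HQ s.
have mE : measurable E by rewrite EQ; apply: bigcup_measurable => k _; exact: mcube.
have mag : measurable_fun (cube q0) (fun x => `|g x|) by exact: measurableT_comp.
pose F k := if s%:E < oscillation f (Q k) then cube (Q k) else set0.
have EF : E = \bigcup_k F k.
  rewrite EQ; apply/seteqP; split => [x [k /= sk Qx]|x [k _]].
    by exists k => //; rewrite /F sk.
  by rewrite /F; case: ifPn => // sk Qx; exists k.
pose U m := \big[setU/set0]_(i < m.+1) F i.
have UE : \bigcup_m U m = E by rewrite EF bigcup_bigsetU_bigcup.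
have mF k : measurable (F k) by rewrite /F; case: ifP => _ //; exact: mcube.
have mU m : measurable (U m) by apply: bigsetU_measurable => i _; exact: mF.
have ndU : nondecreasing_seq U.
  by move=> i j ij; apply/subsetPset; exact: subset_bigsetU.
have Us m : U m = \big[setU/set0]_(q <-
    [seq Q k | k <- iota 0 m.+1 & s%:E < oscillation f (Q k)]) cube q.
  rewrite big_map big_filter /U -(big_mkord xpredT) /index_iota subn0 [RHS]big_mkcond.
  by [].
have weak m : lambda (U m) <= (s^-1 * 3 ^+ n)%:E * \int[lambda]_(x in E) `|g x|.
  rewrite EFinM -muleA lee_pdivlMl//.
  apply: (@le_trans _ _ ((3 ^+ n)%:E * \int[lambda]_(x in U m) `|g x|)); last first.
    rewrite lee_wpmul2l ?lee_fin ?exprn_ge0//; apply: ge0_subset_integral => //.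
      by apply: measurable_funS mag => // x [].
    by rewrite -UE; exact: bigcup_sup.
  rewrite Us; apply: (@vitali_integral _ _ (cube q0)) => //; first exact: ltW.
  move=> q /mapP[k]; rewrite mem_filter => /andP[sk _] ->.
  have [Q_gt0 Qq0] := Q0 k; split => //.
  have := ltW (lt_le_trans sk (fg _ (Q0 k))).
  rewrite (averageE _ (ltW Q_gt0)) => h.
  have V0 : (0 < (Q k).2 ^+ n)%R by rewrite exprn_gt0.
  by rewrite muleC [X in X * _](@lebn_cube _ _ (Q k)) ?(ltW Q_gt0)// -lee_pdivlMl.
have cv := nondecreasing_cvg_mu mU (bigcup_measurable (fun k _ => mU k)) ndU (mu := lambda).
rewrite UE in cv.
have : lambda E <= (s^-1 * 3 ^+ n)%:E * \int[lambda]_(x in E) `|g x|.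
  rewrite -(cvg_lim _ cv)//; apply: lime_le.
    by apply/cvg_ex; eexists; exact: cv.
  by apply: nearW => m; exact: weak.
by rewrite EFinM -muleA lee_pdivlMl.
Qed.

(** A single cube is an admissible family. For fixed [y], [|Q| |f y - f_Q|] is the absolute value of
    the integral of [f x - f y] in [x], hence at most the inner integral. *)
Lemma garo_oscillation_le f g q : lambda.-integrable (cube q0) f ->
  Gamma_class q0 f g -> subcube q0 q ->
  oscillation f q <= average (fun x => `|g x|) (cube q).
Proof.
move=> fi [gi Hg] sq; have q_gt0 := sq.1.
have fq := subcube_integrable fi sq; have gq := subcube_integrable gi sq.
have mf := measurable_int _ fq.
pose V := (q.2 ^+ n)%R; have V0 : (0 < V)%R by rewrite exprn_gt0.
have fam : cube_family q0 [set 0%N] (fun=> q).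
  by split => // i j /= -> ->.
have := Hg _ _ fam; rewrite !eseries_set1 lebn_cube ?(ltW q_gt0)//= => H.
rewrite /oscillation [leLHS](averageE _ (ltW q_gt0)) [leRHS](averageE _ (ltW q_gt0)).
rewrite lee_wpmul2l ?lee_fin ?invr_ge0 ?(ltW V0)//.
apply: le_trans (_ : \int[lambda]_(x in cube q) g x <= _); last first.
  apply: le_trans (lee_abs _) _; apply: le_abse_integral => //.
  exact: measurable_int gq.
apply: le_trans H; rewrite lee_pdivlMl//.
rewrite -ge0_integralZl ?lee_fin ?(ltW V0)//; last exact: measurable_abse_subr.
apply: ge0_le_integral_unmeasurable => [x _|y qy].
  by rewrite mule_ge0// lee_fin ltW.
pose r := fine (average f (cube q)).
have rE : average f (cube q) = r%:E by rewrite fineK// average_fin// ltW.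
have IE : \int[lambda]_(x in cube q) f x = (V * r)%:E.
  rewrite EFinM -rE (averageE _ (ltW q_gt0)) muleA -EFinM mulfV ?gt_eqF// mul1e//.
(* An integrable [f] may still be infinite at [y]; as [f x] is finite almost everywhere, the inner
   integral is then infinite. *)
have foo a : `|a| = +oo -> V%:E * `|a - average f (cube q)| <=
    \int[lambda]_(x in cube q) `|f x - a|.
  move=> aoo; suff -> : \int[lambda]_(x in cube q) `|f x - a| = +oo by rewrite leey.
  rewrite (ae_eq_integral (cst +oo)) => //; last 2 first.
  - exact: measurable_abse_subr.
  - have := integrable_ae (mcube q) fq; apply: filterS => x fx qx.
    by move: aoo (fx qx); case: a => // _; case: (f x).
  rewrite integral_cst// [X in _ * X](@lebn_cube _ _ q) ?(ltW q_gt0)//.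
  by rewrite gt0_mulye// lte_fin.
case fy : (f y) => [t| |]; [|exact: foo|exact: foo].
rewrite rE -EFinB /=.
have -> : V%:E * `|t - r|%:E = `|\int[lambda]_(x in cube q) (f x - t%:E)|.
  rewrite integralB//; last exact: integrable_cst_cube (ltW q_gt0).
  rewrite IE (integral_cst lambda (mcube q) t%:E).
  rewrite [X in _ - _ * X](@lebn_cube _ _ q) ?(ltW q_gt0)// -!EFinM -EFinB /=.
  by congr EFin; rewrite -{1}(gtr0_norm V0) -normrM distrC mulrBr (mulrC V t) distrC.
by apply: le_abse_integral => //; exact: emeasurable_funB.
Qed.

(** Cube by cube: [|f x - f y| <= |f x| + |f y|], and each summand has double integral [|Q|] times
    the integral of [|f|]. *)
Lemma Gamma_class_2abs f : lambda.-integrable (cube q0) f ->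
  Gamma_class q0 f (fun x => 2%:E * `|f x|).
Proof.
move=> fi; split.
  by apply: integrableZl => //; exact: integrable_abse.
move=> I Q [HQ _]; apply: lee_nneseries => [i _ _|i].
  rewrite mule_ge0 ?lee_fin ?invr_ge0 ?fine_ge0//.
  by apply: integral_ge0 => y _; exact: integral_ge0.
rewrite inE => /HQ sq; have q_gt0 := sq.1; set q := Q i in sq q_gt0 *.
have fq := subcube_integrable fi sq; have mf := measurable_int _ fq.
have maf : measurable_fun (cube q) (fun x => `|f x|) by exact: measurableT_comp.
pose V := (q.2 ^+ n)%R; have V0 : (0 < V)%R by rewrite exprn_gt0.
rewrite lebn_cube ?(ltW q_gt0)//= lee_pdivrMl//.
set J := \int[lambda]_(x in cube q) `|f x|.
have J0 : 0 <= J by exact: integral_ge0.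
apply: (@le_trans _ _ (\int[lambda]_(y in cube q) (J + V%:E * `|f y|))).
  apply: ge0_le_integral_unmeasurable => [y _|y qy]; first exact: integral_ge0.
  apply: (@le_trans _ _ (\int[lambda]_(x in cube q) (`|f x| + `|f y|))).
    apply: ge0_le_integral_unmeasurable => // x _.
    exact: lee_abs_sub.
  rewrite ge0_integralD// (integral_cst lambda (mcube q) `|f y|).
  by rewrite [X in _ + _ * X](@lebn_cube _ _ q) ?(ltW q_gt0)// muleC.
rewrite ge0_integralD//; last 2 first.
- by move=> y _; rewrite mule_ge0// lee_fin ltW.
- exact: measurable_funeM.
rewrite (integral_cst lambda (mcube q) J) ge0_integralZl ?lee_fin ?(ltW V0)//.
rewrite ge0_integralZl// -/J [X in _ * X + _](@lebn_cube _ _ q) ?(ltW q_gt0)//.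
rewrite muleC -ge0_muleDr// lee_wpmul2l ?lee_fin ?(ltW V0)//.
by rewrite -[2%R]/(1 + 1)%R EFinD ge0_muleDl ?lee_fin// !mul1e.
Qed.

End sharp_maximal_theory.

(** * From the Boyd index to GaRo and back *)

Section boyd_to_garo.
Context {R : realType} {n : nat}.
Variable q0 : n.-tuple R * R.
Hypotheses (n0 : (0 < n)%N) (q00 : (0 < q0.2)%R).
Variables (N : (n.-tuple R -> \bar R) -> \bar R) (Nbar : (R -> \bar R) -> \bar R).
Local Notation lambda := (lebn R n).
Hypothesis repN : representation_space lambda (cube q0) N Nbar.

Let mcube : measurable (cube q0). Proof. exact: measurable_cube. Qed.

(* [lambda {f# > s} = m > t] would give
   [s m <= 3^n \int_{f# > s} |gamma| <= 3^n m b H(m) <= 3^n m b H(t)]. *)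
Lemma rearr_sharp_maximal_le f gamma (b t : R) : lambda.-integrable (cube q0) f ->
  Gamma_class q0 f gamma -> (1 < b)%R -> (0 < t)%R ->
  rearr lambda (cube q0) (sharp_maximal q0 f) t <=
  (3 ^+ n * b)%:E * hardy_sum b^-1 (rearr lambda (cube q0) gamma) t.
Proof.
move=> fi Gg b1 t0; have [gi _] := Gg; have mg := measurable_int _ gi.
have b0 : (0 < b)%R by rewrite (lt_trans ltr01).
have a0 : (0 < b^-1)%R by rewrite invr_gt0.
have c0 : (0 < 3 ^+ n * b)%R by rewrite mulr_gt0// exprn_gt0.
set H := hardy_sum _ _.
have H0 u : 0 <= H u by apply: hardy_sum_ge0 => // v; exact: rearr_ge0.
have niH : nonincreasing_on_line H.
  apply: hardy_sum_nonincreasing => // [v|v w vw]; first exact: rearr_ge0.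
  exact: rearr_nonincreasing.
have msh := measurable_sharp_maximal n0 q00 fi.
have [Hoo|Hoo] := eqVneq (H t) +oo.
  by rewrite Hoo gt0_muley ?lte_fin// leey.
have Hfin : H t \is a fin_num by rewrite ge0_fin_numE ?ltey.
pose s := (3 ^+ n * b * fine (H t))%R.
have -> : (3 ^+ n * b)%:E * H t = s%:E by rewrite /s [RHS]EFinM fineK.
have s_ge0 : (0 <= s)%R by rewrite mulr_ge0 ?(ltW c0)// fine_ge0.
(* The margin [e] makes the level positive even when [s = 0], and makes the final [(s + e) m <= s m]
   absurd. *)
apply/lee_addgt0Pr => e e0; rewrite -EFinD; apply: rearr_le.
  by rewrite addr_ge0// ltW.
have se0 : (0 < s + e)%R by rewrite ltr_wpDl.
have := sharp_maximal_weak_type n0 q00 fi mg (fun q => garo_oscillation_le fi Gg) se0.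
have -> : cube q0 `&` [set x | (s + e)%:E < `|sharp_maximal q0 f x|] =
    cube q0 `&` [set x | (s + e)%:E < sharp_maximal q0 f x].
  apply/seteqP; split => x [q0x /=]; by rewrite gee0_abs ?sharp_maximal_ge0.
set E := _ `&` _ => weak.
have mE : measurable E by exact: emeasurable_fun_o_infty.
rewrite leNgt; apply/negP => tE.
have Efin : lambda E \is a fin_num.
  rewrite ge0_fin_numE//; apply: (@le_lt_trans _ _ (lambda (cube q0))).
    by apply: le_measure; rewrite ?inE// => x [].
  by rewrite lebn_cube ?(ltW q00)// ltry.
pose m := fine (lambda E); have mE' : lambda E = m%:E by rewrite fineK.
have tm : (t < m)%R by rewrite -lte_fin -mE'.
have m0 : (0 < m)%R by exact: lt_trans tm.
have E1 : \int[lambda]_(x in E) `|gamma x| <= (m * b)%:E * H m.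
  by apply: integral_le_hardy_sum => // x [].
have : ((s + e) * m)%:E <= (s * m)%:E.
  rewrite EFinM -mE'; apply: le_trans weak _.
  apply: (@le_trans _ _ ((3 ^+ n)%:E * ((m * b)%:E * H t))).
    rewrite lee_wpmul2l ?lee_fin ?exprn_ge0//; apply: le_trans E1 _.
    by rewrite lee_wpmul2l ?lee_fin ?mulr_ge0 ?(ltW m0) ?(ltW b0)// niH// ltW.
  rewrite -(fineK Hfin) -!EFinM lee_fin /s le_eqVlt; apply/orP; left; apply/eqP.
  by ring.
by rewrite lee_fin ler_pM2r// gerDl leNgt e0.
Qed.

Lemma garo_space_sub_sharp_space (b : R) : (1 < b)%R ->
  dilation_norm Nbar b < b%:E -> garo_space q0 N `<=` sharp_space q0 N.
Proof.
move=> b1 pb f [fi /ereal_inf_lt[_ [gamma Gg <-] Ng]].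
have [riNb NE] := repN; have bN := ri_bfs riNb.
have [gi _] := Gg; have mg := measurable_int _ gi.
have b0 : (0 < b)%R by rewrite (lt_trans ltr01).
have a0 : (0 < b^-1)%R by rewrite invr_gt0.
have c0 : (0 <= 3 ^+ n * b)%R by rewrite mulr_ge0 ?exprn_ge0// ltW.
have msh := measurable_sharp_maximal n0 q00 fi.
split => //; split => //; rewrite NE//.
have NH : Nbar (hardy_sum b^-1 (rearr lambda (cube q0) gamma)) < +oo.
  by apply: hardy_sum_rearr_fspace => //; rewrite -NE.
have mH : measurable_fun unit_itv (hardy_sum b^-1 (rearr lambda (cube q0) gamma)).
  apply: measurable_nonincreasing; apply: hardy_sum_nonincreasing => // [v|v w vw].
    exact: rearr_ge0.
  exact: rearr_nonincreasing.
apply: (@le_lt_trans _ _ (Nbar (fun t => (3 ^+ n * b)%:E *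
    hardy_sum b^-1 (rearr lambda (cube q0) gamma) t))).
  apply: (bfs_le_ge0 bN).
  - by apply: measurable_nonincreasing => v w vw; exact: rearr_nonincreasing.
  - exact: measurable_funeM.
  - by move=> t _; exact: rearr_ge0.
  - by move=> t /unit_itvE/andP[t0 _]; exact: rearr_sharp_maximal_le.
rewrite (bfs_scale_ge0 bN mH c0); apply: lte_mul_pinfty => //.
Qed.

End boyd_to_garo.

(** * Functions of the distance to the lower corner of the cube *)

Section radial.
Context {R : realType} {n : nat}.
Variable q0 : n.-tuple R * R.
Hypotheses (n0 : (0 < n)%N) (q01 : q0.2 = 1%R).
Implicit Types (F : R -> \bar R) (t : R).
Local Notation lambda := (lebn R n).

Definition corner_dist (x : n.-tuple R) : R :=
  (\big[Num.max/0]_(i <- index_enum 'I_n) (tnth x i - tnth q0.1 i))%R.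

(* The volume of the smallest cube with lower corner [q0.1] containing [x]. *)
Definition corner_volume (x : n.-tuple R) : R := (corner_dist x ^+ n)%R.

Definition corner_cube t : n.-tuple R * R := (q0.1, (t `^ n%:R^-1)%R).

Lemma corner_sideX t : (0 <= t)%R -> ((corner_cube t).2 ^+ n = t)%R.
Proof.
move=> t0; rewrite /= -powR_mulrn ?powR_ge0// -powRrM mulVf ?powRr1//.
by rewrite pnatr_eq0 -lt0n.
Qed.

Lemma corner_side_gt0 t : (0 < t)%R -> (0 < (corner_cube t).2)%R.
Proof. exact: powR_gt0. Qed.

Lemma subcube_corner t : (0 < t <= 1)%R -> subcube q0 (corner_cube t).
Proof.
move=> /andP[t0 t1]; split; first exact: corner_side_gt0.
apply: subset_cube => i /=; split => //; rewrite lerD2l q01.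
rewrite -(@ler_pXn2r _ n)// ?nnegrE ?powR_ge0//.
by rewrite (corner_sideX (ltW t0)) expr1n.
Qed.

Lemma lebn_corner_cube t : (0 <= t)%R -> lambda (cube (corner_cube t)) = t%:E.
Proof. by move=> t0; rewrite lebn_cube ?corner_sideX// powR_ge0. Qed.

Lemma corner_cubeP t x : (0 <= t)%R -> cube q0 x ->
  cube (corner_cube t) x <-> (corner_volume x <= t)%R.
Proof.
move=> t0 q0x.
have d0 : (0 <= corner_dist x)%R by exact: bigmax_ge_id.
rewrite -[t in X in _ <-> X](corner_sideX t0) /corner_volume ler_pXn2r ?nnegrE ?powR_ge0//.
split => [h|/bigmax_leP[_ h] i].
  apply/bigmax_leP; split => [|i _]; first exact: powR_ge0.
  by have /andP[_] := h i; rewrite lerBlDl.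
by have /andP[-> _] := q0x i; rewrite -lerBlDl h// mem_index_enum.
Qed.

Lemma measurable_corner_volume : measurable_fun setT corner_volume.
Proof.
apply: measurable_funX; rewrite /corner_dist.
elim: (index_enum _) => [|i s IH].
  by under eq_fun do rewrite big_nil; exact: measurable_cst.
under eq_fun do rewrite big_cons; apply: measurable_maxr => //.
by apply: measurable_funB => //; exact: measurable_tnth.
Qed.

Section radial_function.
Variable F : R -> \bar R.
Hypotheses (F0 : forall t, 0 <= F t) (niF : nonincreasing_on_line F).
Let f x := F (corner_volume x).
Let mcube (q : n.-tuple R * R) : measurable (cube q).
Proof. exact: measurable_cube. Qed.

Lemma measurable_radial (D : set (n.-tuple R)) : measurable_fun D f.
Proof.
apply: measurable_funTS.
apply: (@measurableT_comp _ _ _ _ _ _ F _ corner_volume).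
  exact: measurable_nonincreasing.
exact: measurable_corner_volume.
Qed.

(** Where [f] exceeds [F t] one is inside the corner cube of volume [t]. Equality can fail at a jump
    of [F], since [f^*] is right-continuous. *)
Lemma rearr_radial_le t : (0 < t)%R -> rearr lambda (cube q0) f t <= F t.
Proof.
move=> t0; have := F0 t; case Ft : (F t) => [s| |] // s0; last by rewrite leey.
apply: rearr_le => //; rewrite -(lebn_corner_cube (ltW t0)).
apply: le_measure; rewrite ?inE//.
  by apply: measurable_abse_gt => //; exact: measurable_radial.
move=> x [q0x /=]; rewrite gee0_abs ?F0// -Ft => Fx.
apply/(corner_cubeP (ltW t0) q0x); rewrite leNgt; apply/negP => tx.
by move: Fx; rewrite ltNge niF// ltW.
Qed.

Lemma corner_cube_sub t : (0 < t <= 1)%R -> cube (corner_cube t) `<=` cube q0.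
Proof. by move=> /subcube_corner []. Qed.

Lemma corner_cube_mono t u : (0 < t)%R -> (t <= u)%R -> (u <= 1)%R ->
  cube (corner_cube t) `<=` cube (corner_cube u).
Proof.
move=> t0 tu u1 x tx.
have q0x : cube q0 x by apply: corner_cube_sub tx; rewrite t0 (le_trans tu).
apply/(corner_cubeP _ q0x); first by rewrite (le_trans (ltW t0)).
by apply: le_trans tu; apply/(corner_cubeP (ltW t0) q0x).
Qed.

Lemma lebn_corner_shell t u : (0 < t)%R -> (t <= u)%R -> (u <= 1)%R ->
  lambda (cube (corner_cube u) `\` cube (corner_cube t)) = (u - t)%:E.
Proof.
move=> t0 tu u1; rewrite measureD//; last first.
  by rewrite [ltLHS](@lebn_corner_cube u) ?ltry// (le_trans (ltW t0)).
rewrite setIidr; last exact: corner_cube_mono.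
rewrite [X in X - _](@lebn_corner_cube u) ?(le_trans (ltW t0))//.
by rewrite [X in _ - X](@lebn_corner_cube t) ?ltW.
Qed.

Lemma radial_ge t x : (0 < t <= 1)%R -> cube (corner_cube t) x -> F t <= f x.
Proof.
move=> t01 tx; apply: niF; apply/corner_cubeP => //.
  by move/andP : t01 => [/ltW].
exact: corner_cube_sub tx.
Qed.

Lemma radial_le t x : (0 < t)%R -> cube q0 x -> ~ cube (corner_cube t) x ->
  f x <= F t.
Proof.
move=> t0 q0x ntx; apply: niF; rewrite leNgt; apply/negP => xt.
by apply: ntx; apply/(corner_cubeP (ltW t0) q0x); exact: ltW.
Qed.

Lemma integral_radial_split (g : n.-tuple R -> \bar R) t u :
  (0 < t)%R -> (t <= u)%R -> (u <= 1)%R ->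
  measurable_fun (cube q0) g -> (forall x, 0 <= g x) ->
  \int[lambda]_(x in cube (corner_cube u)) g x =
  \int[lambda]_(x in cube (corner_cube u) `\` cube (corner_cube t)) g x +
  \int[lambda]_(x in cube (corner_cube t)) g x.
Proof.
move=> t0 tu u1 mg g0.
have tu' := corner_cube_mono t0 tu u1.
have u01 : (0 < u <= 1)%R by rewrite (lt_le_trans t0).
have UE : cube (corner_cube u) `\` cube (corner_cube t) `|` cube (corner_cube t) =
  cube (corner_cube u) by rewrite setUC setDUK.
rewrite -ge0_integral_setU ?UE//.
- exact: measurableD.
- by apply: measurable_funS mg => //; exact: corner_cube_sub.
- by apply/disj_setPS => x [[]].
Qed.

(** Peel off the shell between the corner cubes of volumes [u/2] and [u]: it has measure [u/2] and
    [f >= F u] there. Repeating at [u/2], [u/4], and so on produces the partial sums of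
    [hardy_sum]. *)
Lemma integral_radial_ge t : (0 < t <= 1)%R ->
  (t / 2)%:E * hardy_sum 2^-1 F t <= \int[lambda]_(x in cube (corner_cube t)) f x.
Proof.
have a0 : (0 < 2^-1 :> R)%R by [].
have part K : forall u, (0 < u <= 1)%R ->
  (u / 2)%:E * (\sum_(0 <= k < K) (2^-1 ^+ k)%:E * F (u * 2^-1 ^+ k)%R) <=
  \int[lambda]_(x in cube (corner_cube u)) f x.
  elim: K => [|K IH] u /[dup] u01 /andP[u0 u1].
    by rewrite big_geq// mule0; apply: integral_ge0 => x _; exact: F0.
  have u2 : (0 < u / 2)%R by rewrite divr_gt0.
  have u2u : (u / 2 <= u)%R by lra.
  rewrite (integral_radial_split u2 u2u u1) //; last 2 first.
  - exact: measurable_radial.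
  - by move=> x; exact: F0.
  rewrite big_nat_recl//= expr0 mul1e mulr1 ge0_muleDr//; last first.
    by rewrite sume_ge0// => k _; rewrite mule_ge0// lee_fin exprn_ge0.
  apply: leeD.
    apply: (@le_trans _ _ (\int[lambda]_(x in cube (corner_cube u) `\`
        cube (corner_cube (u / 2))) F u)).
      rewrite (integral_cst _ _ (F u)); last exact: measurableD.
      rewrite [X in _ <= _ * X](lebn_corner_shell u2 u2u u1) muleC.
      by rewrite (_ : u - u / 2 = u / 2)%R//; lra.
    apply: ge0_le_integral_unmeasurable => // x [ux _].
    exact: radial_ge ux.
  apply: le_trans (IH _ _); last by rewrite u2 (le_trans u2u).
  rewrite [X in X <= _](_ : _ = (u / 2 / 2)%:E *
      \sum_(0 <= k < K) (2^-1 ^+ k)%:E * F (u / 2 * 2^-1 ^+ k)%R)//.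
  rewrite [in RHS]EFinM -muleA; congr (_ * _).
  rewrite ge0_sume_distrr; last by move=> k _; rewrite mule_ge0// lee_fin exprn_ge0.
  apply: eq_bigr => k _; rewrite muleA -EFinM -exprS; congr (_ * F _).
  by rewrite exprS mulrA.
move=> /[dup] t01 /andP[t0 t1].
have t2 : (0 < t / 2)%R by rewrite divr_gt0.
rewrite -lee_pdivlMl//; apply: lime_le.
  by apply: is_cvg_nneseries => k _ _; exact: hardy_sum_term_ge0.
by apply: nearW => K; rewrite lee_pdivlMl//; exact: part.
Qed.

(** Both halves of the cube of volume [2t] are compared with its mean [c]: on the inner cube
    [f <= |f - c| + c], and on the outer shell, also of measure [t], [c <= |f - c| + F t]. Each
    comparison costs at most [2t] times the oscillation. *)
Lemma integral_radial_le t : (0 < t)%R -> (2 * t <= 1)%R ->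
  lambda.-integrable (cube q0) f ->
  \int[lambda]_(x in cube (corner_cube t)) f x <=
  (4 * t)%:E * oscillation f (corner_cube (2 * t)) + t%:E * F t.
Proof.
move=> t0 t1 fi.
have t2 : (t <= 2 * t)%R by lra.
have t20 : (0 < 2 * t)%R by lra.
have t201 : (0 < 2 * t <= 1)%R by rewrite t20.
have s2 := subcube_corner t201.
pose Q := cube (corner_cube (2 * t)); pose Q' := cube (corner_cube t).
have mQ : measurable Q by exact: mcube.
have mQ' : measurable Q' by exact: mcube.
have Q'Q : Q' `<=` Q by exact: corner_cube_mono.
have Qq0 : Q `<=` cube q0 by exact: corner_cube_sub.
have f2 := subcube_integrable fi s2.
pose c := fine (average f Q).
have cE : average f Q = c%:E by rewrite fineK// average_fin//; exact: powR_ge0.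
have c0 : (0 <= c)%R.
  rewrite -lee_fin -cE averageE ?powR_ge0// mule_ge0//.
    by rewrite lee_fin invr_ge0 exprn_ge0// powR_ge0.
  by apply: integral_ge0 => x _; exact: F0.
set o := oscillation _ _.
pose h x := `|f x - c%:E|.
have mh : measurable_fun (cube q0) h.
  by apply: measurable_abse_subr; exact: measurable_radial.
have oE : \int[lambda]_(x in Q) h x = (2 * t)%:E * o.
  rewrite /o /oscillation cE averageE ?powR_ge0// muleA -EFinM.
  by rewrite corner_sideX ?(ltW t20)// mulfV ?gt_eqF// mul1e.
have f_le x : f x <= h x + c%:E.
  rewrite /h; have := F0 (corner_volume x); rewrite -/(f x).
  case: (f x) => [r _|_|//]; last by rewrite /= leey.
  by rewrite -EFinB /= -EFinD lee_fin -lerBlDr ler_norm.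
have c_le x : c%:E <= h x + f x.
  rewrite /h; have := F0 (corner_volume x); rewrite -/(f x).
  case: (f x) => [r _|_|//]; last by rewrite /= leey.
  by rewrite -EFinB /= -EFinD lee_fin -lerBlDr distrC ler_norm.
have h0 x : 0 <= h x by exact: abse_ge0.
have hsub A : measurable A -> A `<=` Q -> \int[lambda]_(x in A) h x <= (2 * t)%:E * o.
  move=> mA AQ; rewrite -oE; apply: ge0_subset_integral => //.
  exact: (measurable_funS (mcube q0) Qq0 mh).
have E1 : \int[lambda]_(x in Q') f x <= (2 * t)%:E * o + (c * t)%:E.
  apply: (@le_trans _ _ (\int[lambda]_(x in Q') (h x + c%:E))).
    by apply: ge0_le_integral_unmeasurable => // x _; exact: F0.
  rewrite ge0_integralD//; last by apply: measurable_funS mh => // x /Q'Q/Qq0.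
  rewrite (integral_cst _ (mcube _) c%:E) [X in _ + _ * X](@lebn_corner_cube t) ?(ltW t0)//.
  by rewrite -EFinM leeD2r// hsub.
have E2 : (c * t)%:E <= (2 * t)%:E * o + t%:E * F t.
  have mS : measurable (Q `\` Q') by exact: measurableD.
  have lS : lambda (Q `\` Q') = t%:E.
    by rewrite [LHS](lebn_corner_shell t0 t2 t1); congr EFin; lra.
  have -> : (c * t)%:E = \int[lambda]_(x in Q `\` Q') c%:E.
    by rewrite (integral_cst _ mS c%:E) [X in _ * X]lS EFinM.
  apply: (@le_trans _ _ (\int[lambda]_(x in Q `\` Q') (h x + F t))).
    apply: ge0_le_integral_unmeasurable => // x [Qx nQ'x].
    by apply: le_trans (c_le x) _; rewrite leeD2l// radial_le//; exact: Qq0.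
  rewrite ge0_integralD//; last by apply: measurable_funS mh => // x [/Qq0].
  rewrite (integral_cst _ mS (F t)) [X in _ + _ * X <= _]lS.
  by apply: leeD; [apply: hsub => // x []|rewrite muleC].
apply: le_trans E1 _; apply: le_trans (leeD2l _ E2) _.
rewrite addeA -ge0_muleDl; last 2 first.
- by rewrite lee_fin ltW.
- by rewrite lee_fin ltW.
by rewrite -EFinD (_ : 2 * t + 2 * t = 4 * t)%R//; lra.
Qed.

End radial_function.
End radial.

(** * From the inclusion of the space in its sharp space to a small dilation norm *)

Section sharp_to_boyd.
Context {R : realType} {n : nat}.
Variable q0 : n.-tuple R * R.
Hypotheses (n0 : (0 < n)%N) (q01 : q0.2 = 1%R).
Variables (N : (n.-tuple R -> \bar R) -> \bar R) (Nbar : (R -> \bar R) -> \bar R).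
Local Notation lambda := (lebn R n).
Local Notation leb := (@lebesgue_measure R).
Hypothesis repN : representation_space lambda (cube q0) N Nbar.
Hypothesis sub : fspace (cube q0) N `<=` sharp_space q0 N.
Let riNb := repN.1.
Let bN := ri_bfs riNb.

(** Dividing the two bounds on the integral of the radial function by [t/2] turns the coefficients
    [4t] and [t] into 8 and 2. For [t > 1/2], where the cube of volume [2t] would leave [q0],
    monotonicity bounds the sum by its value at [1/2]. *)
Lemma hardy_sum_fspace F : (forall t, 0 <= F t) -> nonincreasing_on_line F ->
  Nbar F < +oo -> Nbar (hardy_sum 2^-1 F) < +oo.
Proof.
move=> F0 niF NF; have NE := repN.2.
have a0 : (0 < 2^-1 :> R)%R by [].
pose f x := F (corner_volume q0 x).
have mf D : measurable_fun D f by exact: measurable_radial.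
have mF : measurable_fun unit_itv F by exact: measurable_nonincreasing.
have mrearr g : measurable_fun unit_itv (rearr lambda (cube q0) g).
  by apply: measurable_nonincreasing => t u; exact: rearr_nonincreasing.
have ff : fspace (cube q0) N f.
  split; first exact: mf.
  rewrite NE//; apply: le_lt_trans NF.
  apply: (bfs_le_ge0 bN) => //; [exact: mrearr|by move=> t _; exact: rearr_ge0|].
  by move=> t /unit_itvE/andP[t0 _]; exact: rearr_radial_le.
have [fi [msh Nsh]] := sub ff; rewrite NE// in Nsh.
pose r := rearr lambda (cube q0) (sharp_maximal q0 f).
(* The sharp maximal function is at least this oscillation on the whole corner cube, whose volume
   [2t] is strictly larger than [t]. *)
have osc_le t : (0 < t)%R -> (2 * t <= 1)%R ->
    oscillation f (corner_cube q0 (2 * t)) <= r t.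
  move=> t0 t1; have t2 : (0 < 2 * t)%R by rewrite mulr_gt0.
  have s2 : subcube q0 (corner_cube q0 (2 * t)) by apply: subcube_corner; rewrite ?t2.
  apply: le_rearr => //; first exact: measurable_cube.
  apply: (@lt_le_trans _ _ (lambda (cube (corner_cube q0 (2 * t))))).
    by rewrite lebn_corner_cube ?(ltW t2)// lte_fin; lra.
  apply: le_measure; rewrite ?inE; first exact: measurable_cube.
    apply: emeasurable_fun_c_infty; first exact: measurable_cube.
    by apply: measurableT_comp => //.
  move=> x Qx; split; first exact: s2.2.
  by apply: le_trans (lee_abs _); exact: sharp_maximal_ge.
have Hle t : (0 < t)%R -> (2 * t <= 1)%R ->
    hardy_sum 2^-1 F t <= 2%:E * F t + 8%:E * r t.
  move=> t0 t1; have t2 : (0 < t / 2)%R by rewrite divr_gt0.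
  have t01 : (0 < t <= 1)%R by rewrite t0; lra.
  have r0 : 0 <= r t by exact: rearr_ge0.
  rewrite -(@lee_pmul2l _ (t / 2)%:E)//.
  apply: le_trans (integral_radial_ge n0 q01 F0 niF t01) _.
  apply: le_trans (integral_radial_le n0 q01 F0 niF t0 t1 fi) _.
  apply: (@le_trans _ _ ((4 * t)%:E * r t + t%:E * F t)).
    apply: leeD => //; apply: lee_wpmul2l; last exact: osc_le.
    by rewrite lee_fin mulr_ge0// ltW.
  rewrite addeC ge0_muleDr; last 2 first.
  - by rewrite mule_ge0.
  - by rewrite mule_ge0.
  rewrite !muleA -!EFinM divfK// (_ : t / 2 * 8 = 4 * t)%R; last lra.
  exact: lexx.
(* Finite because membership in the sharp space includes integrability of [f]. *)
have H2 : hardy_sum 2^-1 F 2^-1 < +oo.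
  have h01 : (0 < (2^-1 : R) <= 1)%R by rewrite a0 invf_le1// ler1n.
  have h2 : (0 < (2^-1 / 2)^-1 :> R)%R by rewrite invr_gt0 divr_gt0.
  have := integral_radial_ge n0 q01 F0 niF h01.
  rewrite -lee_pdivlMl ?divr_gt0// => /le_lt_trans; apply.
  apply: lte_mul_pinfty; [by rewrite lee_fin ltW|by []|].
  have := integrable_fin_num (measurable_cube _)
    (subcube_integrable fi (subcube_corner n0 q01 h01)).
  by rewrite fin_numElt => /andP[].
have H0 t : 0 <= hardy_sum 2^-1 F t by exact: hardy_sum_ge0.
have niH := hardy_sum_nonincreasing a0 F0 niF.
pose c := fine (hardy_sum 2^-1 F 2^-1).
have cE : hardy_sum 2^-1 F 2^-1 = c%:E by rewrite fineK// ge0_fin_numE.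
have c0 : (0 <= c)%R by rewrite fine_ge0.
have m1 : measurable_fun unit_itv (fun t => 2%:E * F t) by exact: measurable_funeM.
have m2 : measurable_fun unit_itv (fun t => 8%:E * r t).
  by apply: measurable_funeM; exact: mrearr.
have m3 : measurable_fun unit_itv (fun t : R => c%:E * cst 1 t) by exact: measurable_cst.
have m12 : measurable_fun unit_itv (fun t => 2%:E * F t + 8%:E * r t).
  exact: emeasurable_funD.
apply: (@le_lt_trans _ _ (Nbar (fun t => 2%:E * F t + 8%:E * r t + c%:E * cst 1 t))).
  apply: (bfs_le_ge0 bN) => //.
  - exact: measurable_nonincreasing.
  - exact: emeasurable_funD.
  move=> t /unit_itvE/andP[t0 t1]; have [th|th] := leP (2 * t)%R 1%R.
    apply: le_trans (Hle _ t0 th) _.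
    by rewrite leeDl// mule1 lee_fin.
  apply: (@le_trans _ _ (c%:E * 1)).
    by rewrite mule1 -cE niH//; lra.
  by rewrite leeDr// adde_ge0// mule_ge0// rearr_ge0.
apply: le_lt_trans (bfs_triangle bN m12 m3) _.
apply: lte_add_pinfty.
  apply: le_lt_trans (bfs_triangle bN m1 m2) _; apply: lte_add_pinfty.
    by rewrite (bfs_scale_ge0 bN mF)// lte_mul_pinfty.
  by rewrite (bfs_scale_ge0 bN (mrearr _))// lte_mul_pinfty.
rewrite (bfs_scale_ge0 bN)// lte_mul_pinfty//; exact: (bfs_Linfty bN).
Qed.

Lemma fspace_rearr f : fspace unit_itv Nbar f ->
  Nbar (rearr leb unit_itv f) = Nbar f.
Proof.
move=> ff; have [mf _] := ff.
have mI : measurable (unit_itv : set (measurableTypeR R)) by exact: measurable_itv.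
have mr : measurable_fun unit_itv (rearr leb unit_itv f).
  by apply: measurable_nonincreasing => t u; exact: rearr_nonincreasing.
apply: (ri_rearr riNb ff mr _).2.
move=> t t0; have [t1|t1] := ltP t 1%R.
  transitivity (rearr leb unit_itv (fun u => rearr leb unit_itv f (u * 1)%R) t).
    by apply: eq_rearr => u _; rewrite mulr1.
  have t01 : (0 < t < 1)%R by rewrite t0.
  by have := rearr_rearr leb mI mf ltr01 t01; rewrite [in RHS]mulr1.
have It : leb unit_itv <= t%:E by rewrite [leLHS]lebesgue_unit_itv lee_fin.
by rewrite !rearr_eq0.
Qed.

(* Gliding hump: if [phi (2^m) >= 2^m] for all [m], then [F := \sum_j 2^-j f_j^*]
   with [f_j] almost extremal for [phi (2^(4^j))] has [||H (H F)|| = +oo]. *)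
Lemma exists_small_dilation_norm : exists2 s : R, (1 < s)%R &
  dilation_norm Nbar s < s%:E.
Proof.
apply: contrapT => nsmall.
have big (s : R) : (1 < s)%R -> s%:E <= dilation_norm Nbar s.
  by move=> s1; rewrite leNgt; apply/negP => h; apply: nsmall; exists s.
(* The weight [2^-j] of the [j]-th hump must be beaten by the gain [m j + 1]; with [m j = 4^j] the
   product still exceeds [2^j]. The halved bound on [f j] below leaves room strictly under the
   supremum [phi (2^(m j))]. *)
pose m j := (4 ^ j)%N.
have m_gt0 j : (0 < m j)%N by rewrite expn_gt0.
have p2 k : (0 < 2 ^+ k :> R)%R by rewrite exprn_gt0.
have /choice[f Hf] : forall j, exists f, [/\ fspace unit_itv Nbar f, Nbar f <= 1 &
    (2 ^+ m j / 2)%:E < Nbar (dilation (2 ^+ m j) f)].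
  move=> j; have : (2 ^+ m j / 2)%:E < dilation_norm Nbar (2 ^+ m j).
    apply: lt_le_trans (big _ _).
      by rewrite lte_fin ltr_pdivrMr// ltr_pMr// ltr1n.
    by rewrite exprn_egt1// ?ltr1n// -lt0n.
  by move=> /ereal_sup_gt[_ [g [fg g1] <-] h]; exists g.
pose g j := rearr leb unit_itv (f j).
have g0 j t : 0 <= g j t by exact: rearr_ge0.
have nig j : nonincreasing_on_line (g j) by move=> t u; exact: rearr_nonincreasing.
have Ng j : Nbar (g j) <= 1 by have [h1 h2 _] := Hf j; rewrite fspace_rearr.
have a0 : (0 < 2^-1 :> R)%R by [].
pose F t := \sum_(0 <= j <oo) (2^-1 ^+ j)%:E * g j t.
have term0 j t : 0 <= (2^-1 ^+ j)%:E * g j t.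
  by rewrite mule_ge0// lee_fin exprn_ge0.
have F0 t : 0 <= F t by exact: nneseries_ge0.
have niF : nonincreasing_on_line F.
  move=> t u tu; apply: lee_nneseries => // j _.
  by rewrite lee_wpmul2l ?lee_fin ?exprn_ge0// nig.
have mg j : measurable_fun unit_itv (g j) by exact: measurable_nonincreasing.
have mt j : measurable_fun unit_itv (fun t => (2^-1 ^+ j)%:E * g j t).
  exact: measurable_funeM.
have NF : Nbar F < +oo.
  have Nsum : \sum_(0 <= j <oo) Nbar (fun t => (2^-1 ^+ j)%:E * g j t) < +oo.
    have := @geometric_nneseries_lty R 1 2^-1 ler01.
    rewrite (ltW a0) invf_lt1// ltr1n => /(_ isT); apply: le_lt_trans.
    apply: lee_nneseries => [j _ _|j _]; first exact: (bfs_ge0 bN (mt j)).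
    rewrite (bfs_scale_ge0 bN (mg j)) ?exprn_ge0// mul1r.
    by rewrite -[leRHS]mule1 lee_wpmul2l ?lee_fin ?exprn_ge0.
  by have [|_] := fspace_nneseries _ bN mt (fun j t _ => term0 j t) Nsum;
    first exact: measurable_itv.
have NH := hardy_sum_fspace F0 niF NF.
have HF0 t : 0 <= hardy_sum 2^-1 F t by exact: hardy_sum_ge0.
have niHF := hardy_sum_nonincreasing a0 F0 niF.
have NHH := hardy_sum_fspace HF0 niHF NH.
have niH := hardy_sum_nonincreasing a0 HF0 niHF.
have hge t k := hardy_sum2_ge a0 t k F0.
move: (hardy_sum _ _) NHH niH hge => H NHH niH hge.
have mH : measurable_fun unit_itv H by exact: measurable_nonincreasing.
have NHfin : Nbar H \is a fin_num by rewrite ge0_fin_numE// (bfs_ge0 bN mH).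
pose M := fine (Nbar H).
(* Keeping only the [j]-th hump of [F] and the [m j]-th diagonal of the double Hardy sum leaves a
   multiple of the dilation of [f j], of norm at least [2^j / 2]. *)
have key j : (j%:R / 2 <= M)%R.
  pose k := m j; pose c : R := ((k.+1%:R * 2^-1 ^+ k) * 2^-1 ^+ j)%R.
  have c0 : (0 <= c)%R by rewrite !mulr_ge0// exprn_ge0.
  have md : measurable_fun unit_itv (dilation (2 ^+ k) (f j)).
    exact: measurable_dilation.
  have : c%:E * Nbar (dilation (2 ^+ k) (f j)) <= Nbar H.
    rewrite -(bfs_scale_ge0 bN md c0); apply: (bfs_le_ge0 bN) => //.
    - exact: measurable_funeM.
    - by move=> t _; rewrite mule_ge0// dilation_ge0.
    move=> t It; rewrite dilationE//; last by rewrite exprn_ege1// ler1n.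
    apply: le_trans (hge t k).
    rewrite /c EFinM -muleA lee_wpmul2l ?lee_fin ?mulr_ge0 ?exprn_ge0//.
    rewrite -exprVn -/(g j _).
    apply: le_trans (nneseries_lim_ge j.+1 _) => //.
    by rewrite big_nat_recr//= leeDr// sume_ge0.
  have [_ _ hj] := Hf j.
  move=> /(le_trans (lee_wpmul2l _ (ltW hj))); rewrite lee_fin => /(_ c0).
  rewrite -(fineK NHfin) -EFinM lee_fin; apply: le_trans.
  rewrite /c exprVn -/k.
  have -> : (k.+1%:R * 2 ^- k * 2^-1 ^+ j * (2 ^+ k / 2) = k.+1%:R * 2^-1 ^+ j / 2 :> R)%R.
    by field; rewrite gt_eqF.
  rewrite ler_pM2r// exprVn ler_pdivlMr// -natrX -natrM ler_nat.
  rewrite /k /m (_ : 4 = 2 * 2)%N// expnMn leqW// leq_mul2r ltnW ?orbT//.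
  exact: ltn_expl.
have := key (Num.truncn (2 * M)).+1.
rewrite ler_pdivrMr// mulrC leNgt => /negP; apply.
exact: truncnS_gt.
Qed.

End sharp_to_boyd.

Theorem theorem6 (R : realType) (n : nat) (q0 : n.-tuple R * R)
    (N : (n.-tuple R -> \bar R) -> \bar R) (Nbar : (R -> \bar R) -> \bar R)
    (n_gt0 : (0 < n)%N) (q0_gt0 : (0 < q0.2)%R)
    (q0_vol1 : lebn R n (cube q0) = 1)
    (riN : ri_space (lebn R n) (cube q0) N)
    (repN : representation_space (lebn R n) (cube q0) N Nbar) :
  (upper_boyd_index Nbar < 1 <-> garo_space q0 N `<=` sharp_space q0 N) /\
  (garo_space q0 N `<=` sharp_space q0 N <->
   fspace (cube q0) N `<=` sharp_space q0 N).
Proof.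
have q01 : q0.2 = 1%R.
  move: q0_vol1; rewrite lebn_cube ?(ltW q0_gt0)// => -[] /eqP.
  by rewrite pexpr_eq1 ?(ltW q0_gt0)// => /eqP.
have i_ii : upper_boyd_index Nbar < 1 -> garo_space q0 N `<=` sharp_space q0 N.
  move=> /(upper_boyd_index_lt1 repN.1)[b b1 pb].
  exact: garo_space_sub_sharp_space b1 pb.
have ii_iii : garo_space q0 N `<=` sharp_space q0 N ->
    fspace (cube q0) N `<=` sharp_space q0 N.
  move=> sub f [mf Nf]; apply: sub.
  have bN := ri_bfs riN.
  have fi : (lebn R n).-integrable (cube q0) f.
    apply/integrableP; split => //; have [C C0 /(_ _ mf) h] := bfs_L1 bN.
    by apply: le_lt_trans h _; rewrite lte_mul_pinfty// lee_fin ltW.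
  split => //; apply: (@le_lt_trans _ _ (N (fun x => 2%:E * `|f x|))).
    by apply: ereal_inf_lbound; exists (fun x => 2%:E * `|f x|) => //;
      exact: Gamma_class_2abs.
  have maf : measurable_fun (cube q0) (fun x => `|f x|) by exact: measurableT_comp.
  rewrite (bfs_scale_ge0 bN maf)// lte_mul_pinfty//.
  apply: le_lt_trans Nf; apply: (bfs_le bN) => // x _.
  by rewrite abse_id.
have iii_i : fspace (cube q0) N `<=` sharp_space q0 N -> upper_boyd_index Nbar < 1.
  move=> sub; apply/(upper_boyd_index_lt1 repN.1).
  exact: exists_small_dilation_norm repN sub.
by split; split; auto.
Qed.
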